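(* Let $M=\mathbb R$ or $M=\mathbb S^1$, let $p$ be a smooth function on $(0,\infty)$ and $P$ a function with $P'=p$, let $\rho_0>0$ be a smooth function on $M$, and let $c>0$. The diffeomorphism equation of the one-dimensional nonlinear wave equation, $$\gamma_x\gamma_{tt}-2\gamma_t\gamma_{tx}-\frac{1}{\gamma_x}\left[p'\left(\frac{\rho_0}{\gamma_x}\right)-\gamma_t^2\right]\gamma_{xx}+\frac{\rho_0'}{\rho_0}\left[p'\left(\frac{\rho_0}{\gamma_x}\right)-\gamma_t^2\right]=0,$$ is the equation for extremals $\gamma$ (of class $\mathcal C^2$ with $\gamma_x>0$) of the action $$\mathfrak b(\gamma;\rho_0)=\int_0^c\int_M b\big(\gamma_t\circ\gamma^{-1},\gamma_x\circ\gamma^{-1},\rho_0\circ\gamma^{-1}\big)\,dx\,dt$$ with $$b(\gamma_t,\gamma_x,\rho_0)=\frac12\left(\frac{\rho_0\gamma_t}{\gamma_x}\right)^2-P\left(\frac{\rho_0}{\gamma_x}\right).$$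
   Context: For each $t$, $\gamma(\cdot,t)$ is a diffeomorphism of $M$, and $\gamma^{-1}$ is its inverse in the space variable at fixed $t$. After the change of variables given by $\gamma$, the action is $$\mathfrak b(\gamma;\rho_0)=\int_0^c\int_M b(\gamma_t,\gamma_x,\rho_0)\,\gamma_x\,dx\,dt .$$ An extremal is a critical point: $\frac{d}{d\varepsilon}\int_0^c\int_M b(\gamma_t+\varepsilon\zeta_t,\gamma_x+\varepsilon\zeta_x,\rho_0)(\gamma_x+\varepsilon\zeta_x)\,dx\,dt\,\big|_{\varepsilon=0}=0$ for all smooth $\zeta$ compactly supported in $(0,c)\times M$ (the integrand being differentiated and integrated over the support of $\zeta$), with $\rho_0$ held fixed. *)

(* Defs.v *)
From HB Require Import structures.
From mathcomp Require Import all_boot all_order all_algebra.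
From mathcomp Require Import all_classical all_reals all_analysis.

Set Implicit Arguments.
Unset Strict Implicit.
Unset Printing Implicit Defensive.

Import Order.TTheory GRing.Theory Num.Theory.
Import numFieldNormedType.Exports.

Local Open Scope ring_scope.
Local Open Scope classical_set_scope.

(* [Circle l] is the circle R/lZ.  Everything living on it is described on the
   universal cover R: real-valued functions are l-periodic, and an
   orientation-preserving self-diffeomorphism f is given by a lift, which
   satisfies f (x + l) = f x + l. *)
Inductive manifold1 (R : realType) := Line | Circle of {posnum R}.
Arguments Line {R}.

Section space.
Context {R : realType}.
Implicit Types (M : manifold1 R) (f : R -> R).

Definition fundamental_domain M : set R :=
  match M with Line => setT | Circle l => `[0, l%:num[ end.

Definition function_on M f : Prop :=
  match M with Line => True | Circle l => forall x, f (x + l%:num) = f x end.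

Definition lift_on M f : Prop :=
  match M with
  | Line => True
  | Circle l => forall x, f (x + l%:num) = f x + l%:num
  end.

End space.

(* Functions of (t, x) are curried, time first. *)
Section regularity.
Context {R : realType}.
Implicit Types g : R -> R -> R.

Definition dt g : R -> R -> R := fun t x => (fun s => g s x)^`() t.
Definition dx g : R -> R -> R := fun t x => (g t)^`() x.

(* Class C^k on an open subset D of the plane. *)
Fixpoint Ck (k : nat) (D : set (R * R)) g : Prop :=
  (forall z, D z -> {for z, continuous (fun w : R * R => g w.1 w.2)}) /\
  match k with
  | 0 => True
  | k'.+1 =>
      [/\ forall z, D z -> derivable (fun s => g s z.2) z.1 1,
          forall z, D z -> derivable (g z.1) z.2 1,
          Ck k' D (dt g) & Ck k' D (dx g)]
  end.

Definition smooth2 (D : set (R * R)) g : Prop := forall k, Ck k D g.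

(* Smoothness on an open subset D of the line. *)
Definition smooth (D : set R) (f : R -> R) : Prop :=
  forall k x, D x -> derivable (f^`(k)) x 1.

(* (0, c) x M, seen in the universal cover. *)
Definition spacetime (c : R) : set (R * R) := `]0, c[ `*` setT.

End regularity.

Section wave.
Context {R : realType}.
Local Notation mu := (@lebesgue_measure R).
Implicit Types (M : manifold1 R) (c : R) (g zeta : R -> R -> R) (p P rho : R -> R).

(* Bijectivity and positivity of the derivative of the C^2 map [g t] make it
   an (orientation-preserving) diffeomorphism. *)
Definition C2_diffeo_path M c g : Prop :=
  Ck 2 (spacetime c) g /\
  (forall t : R, 0 < t < c ->
     [/\ lift_on M (g t), bijective (g t) & forall x, 0 < dx g t x]).

Definition diffeo_equation c p rho g : Prop :=
  forall t x : R, 0 < t < c ->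
    dx g t x * dt (dt g) t x - 2 * dt g t x * dx (dt g) t x
    - (dx g t x)^-1 * (derive1 p (rho x / dx g t x) - dt g t x ^+ 2)
        * dx (dx g) t x
    + derive1 rho x / rho x * (derive1 p (rho x / dx g t x) - dt g t x ^+ 2) = 0.

(* [b v w r], with v, w, r standing for gamma_t, gamma_x, rho_0. *)
Definition lagrangian P (v w r : R) : R :=
  2^-1 * (r * v / w) ^+ 2 - P (r / w).

(* The values of the actions are extended reals, since they may diverge when
   M is the line. *)
Definition action M c (b : R -> R -> R -> R) g rho : \bar R :=
  (\int[mu]_(t in `]0%R, c[) \int[mu]_(y in fundamental_domain M)
     (let x := pinv setT (g t) y in b (dt g t x) (dx g t x) (rho x))%:E)%E.

Definition pulled_back_action M c (b : R -> R -> R -> R) g rho : \bar R :=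
  (\int[mu]_(t in `]0%R, c[) \int[mu]_(x in fundamental_domain M)
     (b (dt g t x) (dx g t x) (rho x) * dx g t x)%:E)%E.

Definition supp zeta : set (R * R) := closure [set z | zeta z.1 z.2 != 0].

(* Smooth functions with compact support in (0, c) x M; on the circle, compactness
   is that of the support over one closed period. *)
Definition test_function M c zeta : Prop :=
  [/\ smooth2 (spacetime c) zeta,
      forall t, function_on M (zeta t),
      supp zeta `<=` spacetime c &
      compact (supp zeta `&` (setT `*` closure (fundamental_domain M)))].

(* The pulled back action of g + eps zeta, integrated over the support of zeta
   only: the integrand does not depend on eps elsewhere. *)
Definition varied_action M c (b : R -> R -> R -> R) g rho zeta (eps : R) : R :=
  \int[mu]_(t in `]0, c[)
    \int[mu]_(x in fundamental_domain M `&` xsection (supp zeta) t)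
      (b (dt g t x + eps * dt zeta t x) (dx g t x + eps * dx zeta t x) (rho x)
       * (dx g t x + eps * dx zeta t x)).

Definition extremal M c (b : R -> R -> R -> R) g rho : Prop :=
  forall zeta, test_function M c zeta ->
    is_derive (0 : R) 1 (varied_action M c b g rho zeta) 0.

End wave.

(* Main.v *)
Require Import Defs.
From mathcomp Require Import all_boot all_order all_algebra.
From mathcomp Require Import all_classical all_reals all_analysis.
From mathcomp Require Import measurable_realfun ring lra.
Import Order.TTheory GRing.Theory Num.Theory.
Import numFieldNormedType.Exports.
Local Open Scope ring_scope.
Local Open Scope classical_set_scope.

(** The two actions agree by the change of variables [y = gamma t x] at fixed
    time, which on the circle maps a period to another period.  For the
    extremals, differentiation under the integral sign gives the first variation
    [\int (A * zeta_t + B * zeta_x)], where [A] and [B] are the partial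
    derivatives of [b v w r * w] in [v] and [w]; integrating by parts on a box
    turns it into [- \int (A_t + B_x) * zeta].  By equality of mixed partial
    derivatives, [A_t + B_x] is [(rho0 / gamma_x)^2] times the left-hand side of
    the diffeomorphism equation, and testing against smooth bumps shows that the
    first variation vanishes identically only if this product does. *)

(** * Iterated integrals over bounded sets of the plane *)

(** Four obstacles shape the details. On the line the action may diverge, so its change of variables
    is an identity of extended reals: monotone convergence settles nonnegative integrands, and
    positive and negative parts do the rest. The varied action is an iterated real integral, which
    takes a default value where an inner integral is infinite; Fubini is therefore used in a form
    where every inner integral is finite, which boundedness on a bounded set ensures. The functions
    [p] and [P] are controlled only on positive arguments, so the variation is expanded only for
    [eps] small enough that [gamma_x + eps * zeta_x] stays positive on the support; compactness
    provides such a radius. Finally, the circle is seen through its cover: a bump must be smooth and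
    periodic at once, which a cosine achieves, and supports are compact only over a closed period
    whereas integrals run over a half-open one. *)

Lemma open_prod_measurable {R : realType} (U : set (R * R)) :
  open U -> measurable U.
Proof.
move=> oU.
(* Measurability in the plane refers to the product sigma-algebra, so [U] is written as the
   countable union of the squares with rational centre and radius that it contains. *)
pose box (q : rat * rat * rat) : set (R * R) :=
  ball (ratr q.1.1 : R) (ratr q.2) `*` ball (ratr q.1.2 : R) (ratr q.2).
have -> : U = \bigcup_q (if pselect (box q `<=` U) then box q else set0).
  apply/seteqP; split=> [[x y] Uxy|z [q _]]; last first.
    by case: pselect => //= bU bz; exact: bU.
  have /nbhs_ballP[e /= e0 eU] : nbhs (x, y) U by exact: open_nbhs_nbhs.
  (* A square of radius [d < e / 2], with centre within [d] of [(x, y)] in each coordinate, contains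
     the point and stays in its [e]-ball. *)
  have e20 : 0 < e / 2 by rewrite divr_gt0.
  have [d] := rat_in_itvoo e20; rewrite in_itv/= => /andP[d0 de].
  have near_rat (v : R) : exists q, `|ratr q - v| < ratr d.
    have vd : v - ratr d < v + ratr d by lra.
    have [q] := rat_in_itvoo vd.
    by rewrite in_itv/= -ltr_distl; exists q.
  have [q1 q1x] := near_rat x; have [q2 q2y] := near_rat y.
  exists (q1, q2, d) => //; case: pselect => [?|nbU]; [by split|exfalso; apply: nbU].
  move=> -[u v] [/= bu bv]; apply: eU; split => /=; rewrite /ball/=.
    rewrite -(subrKA (ratr q1)) (le_lt_trans (ler_normD _ _))// (splitr e).
    by rewrite ltrD ?(lt_trans bu)// distrC (lt_trans q1x).
  rewrite -(subrKA (ratr q2)) (le_lt_trans (ler_normD _ _))// (splitr e).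
  by rewrite ltrD ?(lt_trans bv)// distrC (lt_trans q2y).
apply: countable_bigcupT_measurable => [|q]; first exact: countableP.
case: pselect => ?; last exact: measurable0.
by apply: measurableX; rewrite ball_itv; exact: measurable_itv.
Qed.

Lemma continuous_on_prod_measurable {R : realType} (S : set (R * R))
    (f : R * R -> R) :
  measurable S -> (forall z, S z -> {for z, continuous f}) ->
  measurable_fun S f.
Proof.
move=> mS cf; apply: (measurability _ (RGenOpens.measurableE R)).
move=> _ [_ [a [b ->] <-]].
(* Continuity is known only at points of [S], so the preimage itself may fail to be open; on [S] it
   agrees with its interior. *)
have -> : S `&` f @^-1` `]a, b[ = S `&` interior (f @^-1` `]a, b[).
  apply/seteqP; split=> z [Sz fz]; split=> //; last exact: interior_subset.
  by apply: cf => //; apply: open_nbhs_nbhs; split=> //; exact: interval_open.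
by apply: measurableI => //; apply: open_prod_measurable; exact: open_interior.
Qed.

Lemma continuous_on_compact_bounded {R : realType} {T : topologicalType}
    (K : set T) (f : T -> R) :
  compact K -> (forall z, K z -> {for z, continuous f}) ->
  exists M, forall z, K z -> `|f z| <= M.
Proof.
move=> cK cf.
have cfK : compact (f @` K).
  apply: continuous_compact => //; apply: continuous_in_subspaceT => z.
  by rewrite inE => /cf.
have [M [_ HM]] := compact_bounded cfK.
by exists (M + 1) => z Kz; apply: HM; [rewrite ltrDl|exists z].
Qed.

Lemma measurable_pair_section {R : realType} d1 d2 (T1 : measurableType d1)
    (T2 : measurableType d2) (f : T1 * T2 -> \bar R) :
  measurable_fun setT f ->
  (forall D t, measurable_fun D (fun x => f (t, x))) /\
  (forall D x, measurable_fun D (fun t => f (t, x))).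
Proof.
move=> mf; split=> D u; apply: measurable_funTS.
  by apply: (measurableT_comp mf); exact: pair1_measurable.
by apply: (measurableT_comp mf); exact: pair2_measurable.
Qed.

Lemma lebesgue_measure_segment_lty {R : realType} (a b : R) :
  (lebesgue_measure `[a, b] < +oo)%E.
Proof. by rewrite lebesgue_measure_itv/=; case: ifP => // _; rewrite ltry. Qed.

Section iterated_integrals.
Context {R : realType}.
Local Notation mu := (@lebesgue_measure R).
Variables (a b x0 x1 C : R) (S : set (R * R)) (f : R -> R -> R).
Hypotheses (mS : measurable S) (Sbox : S `<=` `[a, b] `*` `[x0, x1]).
Hypotheses (mf : measurable_fun S (fun z => f z.1 z.2)).
Hypothesis fC : forall z, S z -> `|f z.1 z.2| <= C.

Lemma bounded_prod_integrable :
  (mu \x mu)%E.-integrable S (EFin \o (fun z => f z.1 z.2)).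
Proof.
apply: measurable_bounded_integrable => //; last first.
  exists C; split; first exact: num_real.
  by move=> M CM z Sz; exact: le_trans (fC _ Sz) (ltW CM).
rewrite (@le_lt_trans _ _ ((mu \x mu)%E (`[a, b] `*` `[x0, x1])))//.
  by rewrite le_measure ?inE//; exact: measurableX.
rewrite product_measure1E//= lte_mul_pinfty//.
  by rewrite ge0_fin_numE// lebesgue_measure_segment_lty.
exact: lebesgue_measure_segment_lty.
Qed.

(** Extension by zero turns integrals over sections of [S] into integrals over the whole line, the
    setting of Fubini's theorem. *)
Let fS : R * R -> \bar R := (EFin \o (fun z => f z.1 z.2)) \_ S.

Let ifS : (mu \x mu)%E.-integrable setT fS.
Proof.
have [H _] := @integrable_mkcond _ _ _ (mu \x mu)%E _ (EFin \o (fun z => f z.1 z.2)) mS.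
exact: H bounded_prod_integrable. Qed.

Let xsectionE t : (\int[mu]_(x in xsection S t) (f t x)%:E =
  \int[mu]_x fS (t, x))%E.
Proof.
rewrite integral_mkcond; apply: eq_integral => x _.
by rewrite /fS !patchE mem_xsection.
Qed.

Let ysectionE x : (\int[mu]_(t in ysection S x) (f t x)%:E =
  \int[mu]_t fS (t, x))%E.
Proof.
rewrite integral_mkcond; apply: eq_integral => t _.
by rewrite /fS !patchE mem_ysection.
Qed.

(** The absolute value of [C] is taken because [C] may be negative when [S] is empty. *)
Let fSC t x : (`|fS (t, x)| <= `|C|%:E)%E.
Proof.
rewrite /fS patchE; case: ifPn; rewrite ?abse0 ?lee_fin// inE => Stx.
by rewrite /= (le_trans (fC _ Stx))// ler_norm.
Qed.

(** Fubini's theorem alone gives this for almost every [t]. It is needed for every [t], because the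
    inner real integral is the [fine] of the extended one; it holds since the section is bounded and
    vanishes outside a segment. *)
Let fin1 t : (\int[mu]_x fS (t, x))%E \is a fin_num.
Proof.
apply: integrable_fin_num => //.
have -> : (fun x => fS (t, x)) = ((fun x => fS (t, x)) \_ `[x0, x1]).
  apply/funext => x; rewrite patchE; case: ifPn => // xI.
  rewrite /fS patchE; case: ifPn => //; rewrite inE => /Sbox[_ /= xI'].
  by move: xI; rewrite notin_setE.
apply: (integrable_mkcond _ _).1 => //.
apply: (@le_integrable _ _ _ mu _ _ _ (cst `|C|%:E)) => //.
- exact: (measurable_pair_section _ _ _ _ _ (measurable_int _ ifS)).1.
- move=> x _ /=; rewrite normr_id; exact: fSC.
- apply: (@measurable_bounded_integrable _ _ _ mu (cst `|C|)) => //.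
    exact: lebesgue_measure_segment_lty.
  exact: bounded_cst.
Qed.

Let fin2 x : (\int[mu]_t fS (t, x))%E \is a fin_num.
Proof.
apply: integrable_fin_num => //.
have -> : (fun t => fS (t, x)) = ((fun t => fS (t, x)) \_ `[a, b]).
  apply/funext => t; rewrite patchE; case: ifPn => // xI.
  rewrite /fS patchE; case: ifPn => //; rewrite inE => /Sbox[/= xI' _].
  by move: xI; rewrite notin_setE.
apply: (integrable_mkcond _ _).1 => //.
apply: (@le_integrable _ _ _ mu _ _ _ (cst `|C|%:E)) => //.
- exact: (measurable_pair_section _ _ _ _ _ (measurable_int _ ifS)).2.
- move=> t _ /=; rewrite normr_id; exact: fSC.
- apply: (@measurable_bounded_integrable _ _ _ mu (cst `|C|)) => //.
    exact: lebesgue_measure_segment_lty.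
  exact: bounded_cst.
Qed.

Lemma Rintegral_xsection :
  \int[mu]_t \int[mu]_(x in xsection S t) f t x =
  \int[(mu \x mu)%E]_(z in S) f z.1 z.2.
Proof.
rewrite /Rintegral [in RHS]integral_mkcond -integral12_prod_meas1//.
congr fine; apply: eq_integral => t _; rewrite /fubini_F.
by rewrite xsectionE fineK.
Qed.

Lemma Rintegral_ysection :
  \int[mu]_x \int[mu]_(t in ysection S x) f t x =
  \int[(mu \x mu)%E]_(z in S) f z.1 z.2.
Proof.
rewrite /Rintegral [in RHS]integral_mkcond -integral21_prod_meas1//.
congr fine; apply: eq_integral => x _; rewrite /fubini_G.
by rewrite ysectionE fineK.
Qed.

End iterated_integrals.

(** * Change of variables *)

Section change_of_variables.
Context {R : realType}.
Local Notation mu := (@lebesgue_measure R).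

Lemma continuous_segment_integrable (f : R -> R) (a b : R) :
  continuous f -> mu.-integrable `[a, b] (EFin \o f).
Proof.
move=> cf; apply: continuous_compact_integrable; first exact: segment_compact.
exact: continuous_subspaceT.
Qed.

(** For a primitive [K] of [h], the function [K (x + l) - K x] has derivative [h (x + l) - h x = 0],
    hence is constant. *)
Lemma Rintegral_periodic (h : R -> R) (l a : R) :
  0 < l -> continuous h -> (forall x, h (x + l) = h x) ->
  \int[mu]_(x in `[a, a + l]) h x = \int[mu]_(x in `[0, l]) h x.
Proof.
move=> l0 ch hl.
(* The primitive starts strictly below both [a] and [0], so that it is differentiable at both. *)
pose B := Num.min a 0 - 1.
pose K x := \int[mu]_(t in `[B, x]) h t.
have dK x : B < x -> is_derive x 1 K (h x).
  move=> Bx; have xx1 : x < x + 1 by rewrite ltrDl.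
  have [dKx Kx] := continuous_FTC1 xx1 (continuous_segment_integrable _ B (x + 1) ch)
    (Bx : (BLeft B < BRight x)%E) (ch x).
  by apply: DeriveDef; [exact: dKx|rewrite -derive1E; exact: Kx].
have dphi x : B < x -> is_derive x 1 (fun y => K (y + l) - K y) 0.
  move=> Bx.
  have Bxl : B < x + l by rewrite (lt_trans Bx)// ltrDl.
  have := dK _ Bxl => dKl; have := dK _ Bx => dK0.
  have dsh : is_derive x 1 (fun y : R => y + l) 1.
    by apply: is_derive_eq; rewrite addr0.
  have dKs : is_derive x 1 (fun y => K (y + l)) (h (x + l) * 1).
    exact: (@is_derive1_comp R K (fun y => y + l) x _ _ dKl dsh).
  by have := is_deriveB dKs dK0; rewrite mulr1 hl subrr.
have cst_phi x y : B < x -> x < y -> K (x + l) - K x = K (y + l) - K y.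
  move=> Bx xy.
  have [||c _] := MVT xy (df := cst 0) (f := fun z => K (z + l) - K z).
  - by move=> z; rewrite in_itv/= => /andP[xz _]; apply: dphi; exact: lt_trans xz.
  - apply: derivable_within_continuous => z; rewrite in_itv/= => /andP[xz _].
    exact: (@ex_derive _ _ _ _ _ _ _ (dphi _ (lt_le_trans Bx xz))).
  - by rewrite mul0r => /eqP; rewrite subr_eq0 => /eqP.
have KE x : B < x -> K (x + l) - K x = \int[mu]_(t in `[x, x + l]) h t.
  move=> Bx; rewrite /K Rintegral_itvB//.
  - rewrite Rintegral_itv_obnd_cbnd//.
    apply: (@integrableS _ _ _ mu `[x, x + l]) => //; first exact: subset_itv_oc_cc.
    exact: continuous_segment_integrable.
  - exact: continuous_segment_integrable.
  - by rewrite bnd_simp ltW.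
  - by rewrite bnd_simp lerDl ltW.
have Ba : B < a by rewrite /B ltrBlDr (@le_lt_trans _ _ a) ?ltrDl// ge_min lexx.
have B0 : B < 0 by rewrite /B ltrBlDr (@le_lt_trans _ _ 0) ?ltrDl// ge_min lexx orbT.
rewrite -KE// -[X in `[0, X]](add0r l) -KE//.
by have [a0|a0|->//] := ltgtP a 0; [|symmetry]; apply: cst_phi.
Qed.

Variables (phi dphi : R -> R).
Hypothesis phi_bij : bijective phi.
Hypothesis dphiE : forall x : R, is_derive x (1 : R) phi (dphi x).
Hypothesis dphi_gt0 : forall x, 0 < dphi x.
Hypothesis dphi_cont : continuous dphi.

Let psi := pinv setT phi.

Let phiK : cancel phi psi.
Proof. by move=> x; rewrite /psi pinvKV ?inE// => ? ? _ _; exact: bij_inj. Qed.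

Let psiK : cancel psi phi.
Proof. by move=> y; case: phi_bij => g gK Kg; rewrite -{1}(Kg y) phiK Kg. Qed.

Let dphi_derivable (x : R) : derivable phi x 1.
Proof. exact: (@ex_derive _ _ _ _ _ _ _ (dphiE x)). Qed.

Let phi_cont : continuous phi.
Proof.
move=> x; apply: differentiable_continuous; apply/derivable1_diffP.
exact: dphi_derivable.
Qed.

Let psi_cont : continuous psi.
Proof.
move=> y; rewrite -(psiK y).
have cpsi : \forall z \near phi (psi y), {for z, continuous psi}.
  by apply: near_can_continuous; near=> x; [exact: phiK|exact: phi_cont].
exact: nbhs_singleton cpsi.
Unshelve. all: by end_near. Qed.

Let phi1E : phi^`() = dphi.
Proof. by apply/funext => x; rewrite derive1E; exact: derive_val. Qed.

Lemma diffeo_increasing : {homo phi : x y / x < y}.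
Proof.
move=> x y xy; apply: (@gtr0_derive1_incr _ phi x y) => //.
- by move=> z _; rewrite phi1E.
- exact: continuous_subspaceT.
Qed.

Lemma segment_change_of_variables (F : R -> R) (a b : R) :
  a <= b -> continuous F ->
  (\int[mu]_(y in `[phi a, phi b]) (F (psi y))%:E =
   \int[mu]_(x in `[a, b]) (F x * dphi x)%:E)%E.
Proof.
move=> ab cF.
rewrite (integration_by_substitution_increasing ab).
- by apply: eq_integral => x _; rewrite phi1E /= fctE/= phiK.
- by move=> x y _ _; exact: diffeo_increasing.
- by rewrite phi1E => x _; exact: dphi_cont.
- by rewrite phi1E; apply/cvg_ex; exists (dphi a); apply: cvg_at_right_filter; exact: dphi_cont.
- by rewrite phi1E; apply/cvg_ex; exists (dphi b); apply: cvg_at_left_filter; exact: dphi_cont.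
- split.
  + by move=> x _; exact: dphi_derivable.
  + by apply: cvg_at_right_filter; exact: phi_cont.
  + by apply: cvg_at_left_filter; exact: phi_cont.
- apply: continuous_subspaceT => y; apply: continuous_comp; first exact: psi_cont.
  exact: cF.
Qed.

(** Monotone convergence along the segments [[-n, n]] and their images under [phi]; the images
    exhaust the line because [phi] is increasing and onto. *)
Let ge0_line (F : R -> R) : continuous F -> (forall x, 0 <= F x) ->
  (\int[mu]_y (F (psi y))%:E = \int[mu]_x (F x * dphi x)%:E)%E.
Proof.
move=> cF F0.
have mFpsi (D : set R) : measurable_fun D (EFin \o (fun y => F (psi y))).
  apply: measurable_funTS; apply/measurable_EFinP.
  apply: continuous_measurable_fun => y.
  by apply: continuous_comp; [exact: psi_cont|exact: cF].
have mFphi (D : set R) : measurable_fun D (EFin \o (fun x => F x * dphi x)).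
  apply: measurable_funTS; apply/measurable_EFinP.
  by apply: continuous_measurable_fun => y; apply: cvgM; [exact: cF|exact: dphi_cont].
have T1 : [set: R] = \bigcup_n `[phi (- n%:R), phi n%:R].
  apply/seteqP; split=> // y _.
  exists (Num.Def.truncn `|psi y|).+1 => //=.
  have := truncnS_gt `|psi y|; rewrite ltr_norml => /andP[ln nl].
  by rewrite in_itv/= -[X in _ <= X <= _]psiK !ltW// diffeo_increasing.
have T2 : [set: R] = \bigcup_n `[- n%:R, n%:R].
  apply/seteqP; split=> // y _.
  exists (Num.Def.truncn `|y|).+1 => //=.
  have := truncnS_gt `|y|; rewrite ltr_norml => /andP[ln nl].
  by rewrite in_itv/= !ltW.
have Ephi : (fun n : nat => \int[mu]_(y in `[phi (- n%:R)%R, phi n%:R]) (F (psi y))%:E)%E =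
    (fun n : nat => \int[mu]_(x in `[(- n%:R)%R, n%:R]) (F x * dphi x)%:E)%E.
  apply/funext => n; apply: segment_change_of_variables => //.
  by rewrite (@le_trans _ _ 0)// oppr_le0.
have C1 : ((\int[mu]_(y in `[phi (- n%:R)%R, phi n%:R]) (F (psi y))%:E)%E @[n --> \oo]
    --> (\int[mu]_y (F (psi y))%:E)%E).
  rewrite [in X in _ --> X]T1.
  apply: (@ge0_nondecreasing_set_cvg_integral _ (measurableTypeR R) R
    (fun n => `[phi (- n%:R), phi n%:R]) (fun y => (F (psi y))%:E) mu) => //.
  - move=> n m nm; apply/subsetPset => x /=; rewrite !in_itv/= => /andP[nx xn].
    apply/andP; split; [apply: le_trans nx|apply: le_trans xn _];
      by apply: (ltW_homo diffeo_increasing); rewrite ?lerN2 ler_nat.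
  - by move=> n; exact: mFpsi.
  - by move=> n x ?; rewrite lee_fin.
have C2 : ((\int[mu]_(x in `[(- n%:R)%R, n%:R]) (F x * dphi x)%:E)%E @[n --> \oo]
    --> (\int[mu]_x (F x * dphi x)%:E)%E).
  rewrite [in X in _ --> X]T2.
  apply: (@ge0_nondecreasing_set_cvg_integral _ (measurableTypeR R) R
    (fun n => `[- n%:R, n%:R]) (fun x => (F x * dphi x)%:E) mu) => //.
  - move=> n m nm; apply/subsetPset => x /=; rewrite !in_itv/= => /andP[nx xn].
    by apply/andP; split; [apply: le_trans nx|apply: le_trans xn _];
      rewrite ?lerN2 ler_nat.
  - by move=> n; exact: mFphi.
  - by move=> n x ?; rewrite lee_fin mulr_ge0// ltW.
rewrite Ephi in C1.
exact: (cvg_unique (@ereal_hausdorff R) C1 C2).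
Qed.

(** Multiplication by [dphi > 0] commutes with positive and negative parts, so the nonnegative case
    applies to each of them even if both have infinite integral. *)
Lemma line_change_of_variables (F : R -> R) : continuous F ->
  (\int[mu]_y (F (psi y))%:E = \int[mu]_x (F x * dphi x)%:E)%E.
Proof.
move=> cF; rewrite integralE [in RHS]integralE; congr (_ - _)%E.
  transitivity (\int[mu]_y (Num.max (F (psi y)) 0)%:E)%E.
    by apply: eq_integral => y _; rewrite funeposE EFin_max.
  rewrite (ge0_line (fun x => Num.max (F x) 0)).
  - by apply: eq_integral => x _; rewrite funeposE -EFin_max maxr_pMl ?ltW// mul0r.
  - by move=> x; apply: (@continuous_max _ _ F (cst 0)); [exact: cF|exact: cst_continuous].
  - by move=> x; rewrite le_max lexx orbT.
transitivity (\int[mu]_y (Num.max (- F (psi y)) 0)%:E)%E.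
  by apply: eq_integral => y _; rewrite funenegE EFin_max.
rewrite (ge0_line (fun x => Num.max (- F x) 0)).
- by apply: eq_integral => x _; rewrite funenegE -EFinN -EFin_max maxr_pMl ?ltW// mul0r mulNr.
- move=> x; apply: (@continuous_max _ _ (fun x => - F x) (cst 0)); last exact: cst_continuous.
  by apply: cvgN; exact: cF.
- by move=> x; rewrite le_max lexx orbT.
Qed.

(** The period [[0, l]] in [y] pulls back to [[psi 0, psi 0 + l]], and periodicity of the new
    integrand moves it back to [[0, l]]. The endpoint is a null set. *)
Lemma circle_change_of_variables (F : R -> R) (l : R) : 0 < l ->
  continuous F -> (forall x, F (x + l) = F x) ->
  (forall x, phi (x + l) = phi x + l) ->
  (forall x, dphi (x + l) = dphi x) ->
  (\int[mu]_(y in `[0%R, l[) (F (psi y))%:E =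
   \int[mu]_(x in `[0%R, l[) (F x * dphi x)%:E)%E.
Proof.
move=> l0 cF Fl phil dphil.
have cFphi : continuous (fun x => F x * dphi x).
  by move=> x; apply: cvgM; [exact: cF|exact: dphi_cont].
rewrite !integral_itv_bndo_bndc; last 2 first.
- by apply: measurable_funTS; apply/measurable_EFinP; exact: continuous_measurable_fun.
- apply: measurable_funTS; apply/measurable_EFinP.
  apply: continuous_measurable_fun => y.
  by apply: continuous_comp; [exact: psi_cont|exact: cF].
have psil : `[0, l] = `[phi (psi 0), phi (psi 0 + l)] by rewrite phil psiK add0r.
rewrite [in LHS]psil segment_change_of_variables ?lerDl ?ltW//.
have hl x : F (x + l) * dphi (x + l) = F x * dphi x by rewrite Fl dphil.
have iF a b : (\int[mu]_(x in `[a, b]) (F x * dphi x)%:E)%E \is a fin_num.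
  by apply: integrable_fin_num => //; exact: continuous_segment_integrable.
have := Rintegral_periodic _ _ (psi 0) l0 cFphi hl.
by rewrite /Rintegral => periodic; rewrite -(fineK (iF _ _)) periodic fineK.
Qed.

End change_of_variables.

(** * Calculus and mixed partial derivatives *)

Section one_variable_calculus.
Context {R : realType}.
Implicit Types (f g : R -> R) (x a b : R).

Lemma is_derive_derivable f x a : is_derive x (1 : R) f a -> derivable f x 1.
Proof. by case. Qed.

Lemma is_derive_derive1 f x a : is_derive x (1 : R) f a -> f^`() x = a.
Proof. by move=> fa; rewrite derive1E; exact: derive_val. Qed.

Lemma derivable_is_derive1 f x : derivable f x 1 -> is_derive x (1 : R) f (f^`() x).
Proof. by move=> df; apply: DeriveDef; rewrite ?derive1E. Qed.

Lemma is_derive_continuous f x a :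
  is_derive x (1 : R) f a -> {for x, continuous f}.
Proof.
move=> /is_derive_derivable/derivable1_diffP; exact: differentiable_continuous.
Qed.

Lemma is_derive_add f g x a b : is_derive x (1 : R) f a ->
  is_derive x (1 : R) g b -> is_derive x (1 : R) (fun y => f y + g y) (a + b).
Proof. by move=> fa gb; exact: is_deriveD. Qed.

Lemma is_derive_opp f x a : is_derive x (1 : R) f a ->
  is_derive x (1 : R) (fun y => - f y) (- a).
Proof. by move=> fa; exact: is_deriveN. Qed.

Lemma is_derive_mul f g x a b : is_derive x (1 : R) f a ->
  is_derive x (1 : R) g b ->
  is_derive x (1 : R) (fun y => f y * g y) (a * g x + f x * b).
Proof.
move=> fa gb; have := is_deriveM fa gb.
by rewrite /GRing.scale/= addrC [g x * a]mulrC.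
Qed.

Lemma is_derive_inv f x a : f x != 0 -> is_derive x (1 : R) f a ->
  is_derive x (1 : R) (fun y => (f y)^-1) (- a / f x ^+ 2).
Proof.
move=> fx0 fa; have := is_deriveV fx0 fa.
by rewrite /GRing.scale/= mulNr mulrC mulNr.
Qed.

Lemma is_derive_comp f g x a b : is_derive x (1 : R) f a ->
  is_derive (f x) (1 : R) g b -> is_derive x (1 : R) (fun y => g (f y)) (b * a).
Proof. by move=> fa gb; exact: (@is_derive1_comp R g f). Qed.

Lemma is_derive_sqr f x a : is_derive x (1 : R) f a ->
  is_derive x (1 : R) (fun y => f y ^+ 2) (2 * a * f x).
Proof.
move=> fa; have := is_derive_mul _ _ _ _ _ fa fa.
have -> : (fun y => f y * f y) = (fun y => f y ^+ 2) by apply/funext => y; rewrite expr2.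
by have -> : 2 * a * f x = a * f x + f x * a by ring.
Qed.

Lemma is_derive_affine v a x : is_derive x (1 : R) (fun y : R => v + y * a) a.
Proof.
have := is_derive_add _ _ _ _ _ (is_derive_cst v x 1)
  (is_derive_mul _ _ _ _ _ (is_derive_id x 1) (is_derive_cst a x 1)).
by rewrite mul1r mulr0 addr0 add0r.
Qed.

Lemma MVT_closed f df a b : a < b ->
  (forall x, a <= x <= b -> is_derive x (1 : R) f (df x)) ->
  exists2 c, a < c < b & f b - f a = df c * (b - a).
Proof.
move=> ab dfE; have [||c] := MVT ab (f := f) (df := df).
- by move=> x; rewrite in_itv/= => /andP[ax xb]; apply: dfE; rewrite !ltW.
- apply: derivable_within_continuous => x; rewrite in_itv/= => axb.
  exact: is_derive_derivable (dfE _ axb).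
- by rewrite in_itv/= => acb ->; exists c.
Qed.

End one_variable_calculus.

(** For the symmetry of mixed partials: [a] and [b] are the two mixed partials at a point, and [m]
    is a value that both take arbitrarily close to it. *)
Lemma dist_lt_half_absurd {R : realType} (a b m : R) :
  `|a - m| < `|a - b| / 2 -> `|b - m| < `|a - b| / 2 -> False.
Proof.
rewrite [`|b - m|]distrC => am mb; have := ler_normD (a - m) (m - b).
by rewrite subrKA leNgt (splitr `|a - b|) ltrD.
Qed.

(** * Regularity on spacetime and symmetry of mixed partials *)

Section spacetime_regularity.
Context {R : realType}.
Implicit Types (c t x : R) (g : R -> R -> R).

Lemma spacetimeE c t x : spacetime c (t, x) <-> 0 < t < c.
Proof. by rewrite /spacetime /= in_itv/=; split=> [[]|]. Qed.

Lemma spacetime_open c : open (spacetime c).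
Proof.
have -> : spacetime c = fst @^-1` `]0, c[.
  by apply/seteqP; split=> [z []|z]//; split.
by apply: open_comp => [z _|]; [exact: cvg_fst|exact: interval_open].
Qed.

Lemma Ck_continuous k c g t x : Ck k (spacetime c) g -> 0 < t < c ->
  {for (t, x), continuous (fun w : R * R => g w.1 w.2)}.
Proof. by case: k => [|k] [cg _] tc; apply: cg; apply/spacetimeE. Qed.

Lemma Ck1_is_derive_dt k c g t x : Ck k.+1 (spacetime c) g -> 0 < t < c ->
  is_derive t (1 : R) (fun s => g s x) (dt g t x).
Proof.
move=> [_ [dg _ _ _]] tc; apply: derivable_is_derive1.
by apply: (dg (t, x)); apply/spacetimeE.
Qed.

Lemma Ck1_is_derive_dx k c g t x : Ck k.+1 (spacetime c) g -> 0 < t < c ->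
  is_derive x (1 : R) (g t) (dx g t x).
Proof.
move=> [_ [_ dg _ _]] tc; apply: derivable_is_derive1.
by apply: (dg (t, x)); apply/spacetimeE.
Qed.

Lemma Ck_dt k c g : Ck k.+1 (spacetime c) g -> Ck k (spacetime c) (dt g).
Proof. by case=> _ []. Qed.

Lemma Ck_dx k c g : Ck k.+1 (spacetime c) g -> Ck k (spacetime c) (dx g).
Proof. by case=> _ []. Qed.

(** The mean value theorem is applied in time to the increment of [g] in space, then in space to
    [g1]. *)
Lemma corner_difference (g g1 g12 : R -> R -> R) t x h : 0 < h ->
  (forall s y, t <= s <= t + h -> is_derive s (1 : R) (fun s => g s y) (g1 s y)) ->
  (forall s y, t <= s <= t + h -> is_derive y (1 : R) (g1 s) (g12 s y)) ->
  exists s y, [/\ t < s < t + h, x < y < x + h &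
    g (t + h) (x + h) - g (t + h) x - (g t (x + h) - g t x) = g12 s y * h * h].
Proof.
move=> h0 dg dg1.
have th : t < t + h by rewrite ltrDl.
have xh : x < x + h by rewrite ltrDl.
have [|s ts E1] := MVT_closed (fun s => g s (x + h) - g s x)
  (fun s => g1 s (x + h) - g1 s x) _ _ th.
  by move=> s ts; apply: is_derive_add; [|apply: is_derive_opp]; exact: dg.
have ts' : t <= s <= t + h by case/andP: ts => *; rewrite !ltW.
have [|y xy E2] := MVT_closed (g1 s) (g12 s) _ _ xh.
  by move=> y _; exact: dg1.
exists s, y; split => //.
move: E1; rewrite E2 (addrC t h) (addrC x h) !addrK => <-.
by rewrite !opprB; ring.
Qed.

(** The second difference of [g] over a small square is [h * h] times either mixed partial at some
    interior point, so by continuity the two cannot differ at the corner. *)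
Lemma mixed_partials_commute c g t x : Ck 2 (spacetime c) g -> 0 < t < c ->
  dt (dx g) t x = dx (dt g) t x.
Proof.
move=> Cg tc; apply/eqP; rewrite -subr_eq0 -normr_le0 leNgt; apply/negP => e0.
set e := `| _ | in e0.
have e20 : 0 < e / 2 by rewrite divr_gt0.
have c1 := Ck_continuous _ _ _ _ x (Ck_dt _ _ _ (Ck_dx _ _ _ Cg)) tc.
have c2 := Ck_continuous _ _ _ _ x (Ck_dx _ _ _ (Ck_dt _ _ _ Cg)) tc.
have /cvgrPdist_lt/(_ _ e20)/nbhs_ballP[d1 /= d10 H1] := c1.
have /cvgrPdist_lt/(_ _ e20)/nbhs_ballP[d2 /= d20 H2] := c2.
(* The square of side [h] at [(t, x)] lies in both continuity balls and stays before time [c]. *)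
pose h := Num.min (Num.min d1 d2) (c - t) / 2.
have m0 : 0 < Num.min (Num.min d1 d2) (c - t).
  by rewrite !lt_min d10 d20 subr_gt0; case/andP: tc.
have h0 : 0 < h by rewrite divr_gt0.
have hm : h < Num.min (Num.min d1 d2) (c - t) by rewrite ltr_pdivrMr// ltr_pMr// ltr1n.
have [[hd1 hd2] htc] : (h < d1 /\ h < d2) /\ h < c - t.
  by move: hm; rewrite !lt_min => /andP[/andP[-> ->] ->].
have inD s : t <= s <= t + h -> 0 < s < c by move=> /andP[? ?]; lra.
have [s [y [ts xy E]]] := corner_difference g (dt g) (dx (dt g)) t x h h0
  (fun s y ts => Ck1_is_derive_dt _ _ _ s y Cg (inD s ts))
  (fun s y ts => Ck1_is_derive_dx _ _ _ s y (Ck_dt _ _ _ Cg) (inD s ts)).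
have Dx s' y' (ts' : t <= s' <= t + h) := Ck1_is_derive_dx _ _ _ s' y' Cg (inD s' ts').
have Dtx s' y' (ts' : t <= s' <= t + h) :=
  Ck1_is_derive_dt _ _ _ s' y' (Ck_dx _ _ _ Cg) (inD s' ts').
have xh : x < x + h by rewrite ltrDl.
have th : t < t + h by rewrite ltrDl.
(* The same second difference, with the mean value theorem applied in space first and in time
   afterwards. *)
have [|y' xy' E1] := MVT_closed (fun y => g (t + h) y - g t y)
  (fun y => dx g (t + h) y - dx g t y) _ _ xh.
  move=> z _; apply: is_derive_add; [|apply: is_derive_opp]; apply: Dx.
    by rewrite lexx ltW.
  by rewrite lexx/= ltW.
have [s' ts' E2] := MVT_closed (fun s => dx g s y') (fun s => dt (dx g) s y') _ _ th
  (fun z => Dtx z y').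
have EE : dx (dt g) s y = dt (dx g) s' y'.
  have hn0 : h != 0 by rewrite gt_eqF.
  move: E E1; rewrite E2 (addrC t h) (addrC x h) !addrK.
  move: (dx (dt g) s y) (dt (dx g) s' y') => A B E E1.
  apply: (mulIf hn0); apply: (mulIf hn0); rewrite -E -E1; ring.
have B1 : ball (t, x) d1 (s', y').
  by split; rewrite /ball/= ltr_distl; apply/andP; split; lra.
have B2 : ball (t, x) d2 (s, y).
  by split; rewrite /ball/= ltr_distl; apply/andP; split; lra.
have := H2 _ B2; have := H1 _ B1; rewrite /= EE.
exact: dist_lt_half_absurd.
Qed.

End spacetime_regularity.

(** * The Euler-Lagrange expression *)

Section euler_lagrange.
Context {R : realType}.
Variables (p P : R -> R).
Hypothesis p_smooth : smooth [set r : R | 0 < r] p.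
Hypothesis P_primitive : forall r : R, 0 < r -> is_derive r 1 P (p r).

(* The partial derivatives in [v] and [w] of the pulled back Lagrangian
   [lagrangian P v w r * w]. *)
Definition momentum (v w r : R) : R := r ^+ 2 * v / w.

Definition flux (v w r : R) : R :=
  p (r / w) * (r / w) - P (r / w) - 2^-1 * (r * v / w) ^+ 2.

Lemma pressure_is_derive (r : R) : 0 < r -> is_derive r (1 : R) p ((derive1 p) r).
Proof. by move=> r0; apply: derivable_is_derive1; exact: (p_smooth 0 r). Qed.

Lemma dpressure_continuous (r : R) : 0 < r -> {for r, continuous (derive1 p)}.
Proof.
move=> r0; have := p_smooth 1 r r0; rewrite derive1n1 => dp.
exact: is_derive_continuous (derivable_is_derive1 _ _ dp).
Qed.

Lemma is_derive_perturbed_lagrangian (v w dv dw r e : R) :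
  0 < r -> 0 < w + e * dw ->
  is_derive e (1 : R)
    (fun e => lagrangian P (v + e * dv) (w + e * dw) r * (w + e * dw))
    (momentum (v + e * dv) (w + e * dw) r * dv +
     flux (v + e * dv) (w + e * dw) r * dw).
Proof.
move=> r0 w0.
have Dv := is_derive_affine v dv e; have Dw := is_derive_affine w dw e.
have wn0 : w + e * dw != 0 by rewrite gt_eqF.
have Dwi := is_derive_inv (fun y => w + y * dw) e _ wn0 Dw.
have cr := is_derive_cst r e (1 : R); have c2 := is_derive_cst (2^-1 : R) e (1 : R).
have Dq := is_derive_mul _ _ _ _ _ cr Dwi.
have DP := is_derive_comp _ _ _ _ _ Dq (P_primitive _ (divr_gt0 r0 w0)).
have DK := is_derive_mul _ _ _ _ _ c2
  (is_derive_sqr _ _ _ (is_derive_mul _ _ _ _ _ (is_derive_mul _ _ _ _ _ cr Dv) Dwi)).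
have := is_derive_mul _ _ _ _ _ (is_derive_add _ _ _ _ _ DK (is_derive_opp _ _ _ DP)) Dw.
move/is_derive_eq; apply; rewrite /momentum /flux /=.
by field.
Qed.

Lemma is_derive_momentum (v w : R -> R) (dv dw r t : R) :
  w t != 0 -> is_derive t (1 : R) v dv -> is_derive t (1 : R) w dw ->
  is_derive t (1 : R) (fun s => momentum (v s) (w s) r)
    (r ^+ 2 * (dv / w t - v t * dw / w t ^+ 2)).
Proof.
move=> wn0 Dv Dw; rewrite /momentum.
have := is_derive_mul _ _ _ _ _ (is_derive_mul _ _ _ _ _
  (is_derive_cst (r ^+ 2) t (1 : R)) Dv) (is_derive_inv _ _ _ wn0 Dw).
by move/is_derive_eq; apply => /=; field.
Qed.

(** In the derivative of [p q * q - P q] with [q = r / w], the two terms [p q * q'] cancel because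
    [P' = p]; only [p'] survives. *)
Lemma is_derive_flux (v w r : R -> R) (dv dw dr x : R) :
  0 < w x -> 0 < r x ->
  is_derive x (1 : R) v dv -> is_derive x (1 : R) w dw -> is_derive x (1 : R) r dr ->
  is_derive x (1 : R) (fun y => flux (v y) (w y) (r y))
    (derive1 p (r x / w x) * (r x / w x) * (dr / w x - r x * dw / w x ^+ 2)
     - (r x * v x / w x)
       * ((dr * v x + r x * dv) / w x - r x * v x * dw / w x ^+ 2)).
Proof.
move=> w0 r0 Dv Dw Dr; rewrite /flux.
have wn0 : w x != 0 by rewrite gt_eqF.
have Dwi := is_derive_inv _ _ _ wn0 Dw.
have Dq := is_derive_mul _ _ _ _ _ Dr Dwi.
have q0 := divr_gt0 r0 w0.
have DP := is_derive_comp _ _ _ _ _ Dq (P_primitive _ q0).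
have Dp := is_derive_comp _ _ _ _ _ Dq (pressure_is_derive _ q0).
have DK := is_derive_mul _ _ _ _ _ (is_derive_cst (2^-1 : R) x (1 : R))
  (is_derive_sqr _ _ _ (is_derive_mul _ _ _ _ _ (is_derive_mul _ _ _ _ _ Dr Dv) Dwi)).
have := is_derive_add _ _ _ _ _ (is_derive_add _ _ _ _ _
  (is_derive_mul _ _ _ _ _ Dp Dq) (is_derive_opp _ _ _ DP)) (is_derive_opp _ _ _ DK).
by move/is_derive_eq; apply => /=; field.
Qed.

Section continuity.
Context {T : topologicalType}.
Variables (v w r : T -> R) (z : T).
Hypotheses (cv : {for z, continuous v}) (cw : {for z, continuous w}).
Hypotheses (cr : {for z, continuous r}) (w0 : 0 < w z) (r0 : 0 < r z).

(** The parameter space [T] is arbitrary because these facts serve on the line at fixed time, on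
    spacetime, and on spacetime with the variation parameter adjoined. *)
Lemma ratio_continuous : {for z, continuous (fun y => r y / w y)}.
Proof. by apply: cvgM => //; apply: cvgV => //; rewrite gt_eqF. Qed.

Lemma momentum_continuous :
  {for z, continuous (fun y => momentum (v y) (w y) (r y))}.
Proof.
apply: cvgM; last by apply: cvgV => //; rewrite gt_eqF.
by apply: cvgM => //; apply: cvgM.
Qed.

Let kinetic_continuous :
  {for z, continuous (fun y => 2^-1 * (r y * v y / w y) ^+ 2)}.
Proof.
have c : {for z, continuous (fun y => r y * v y / w y)}.
  by apply: cvgM; [apply: cvgM|apply: cvgV => //; rewrite gt_eqF].
by apply: cvgM; [exact: cvg_cst|apply: cvgM].
Qed.

Let primitive_continuous : {for z, continuous (fun y => P (r y / w y))}.
Proof.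
apply: (@continuous_comp _ _ _ (fun y => r y / w y) P); first exact: ratio_continuous.
by apply: is_derive_continuous; apply: P_primitive; rewrite divr_gt0.
Qed.

Lemma flux_continuous : {for z, continuous (fun y => flux (v y) (w y) (r y))}.
Proof.
apply: cvgB; last exact: kinetic_continuous.
apply: cvgB; last exact: primitive_continuous.
apply: cvgM; last exact: ratio_continuous.
apply: (@continuous_comp _ _ _ (fun y => r y / w y) p); first exact: ratio_continuous.
by apply: is_derive_continuous; apply: pressure_is_derive; rewrite divr_gt0.
Qed.

Lemma lagrangian_continuous :
  {for z, continuous (fun y => lagrangian P (v y) (w y) (r y))}.
Proof. by apply: cvgB; [exact: kinetic_continuous|exact: primitive_continuous]. Qed.

Lemma dpressure_ratio_continuous :
  {for z, continuous (fun y => (derive1 p) (r y / w y))}.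
Proof.
apply: (@continuous_comp _ _ _ (fun y => r y / w y) (derive1 p)); first exact: ratio_continuous.
by apply: dpressure_continuous; rewrite divr_gt0.
Qed.

End continuity.

Definition diffeo_operator (rho : R -> R) (g : R -> R -> R) (t x : R) : R :=
  dx g t x * dt (dt g) t x - 2 * dt g t x * dx (dt g) t x
  - (dx g t x)^-1 * (derive1 p (rho x / dx g t x) - dt g t x ^+ 2)
      * dx (dx g) t x
  + derive1 rho x / rho x * (derive1 p (rho x / dx g t x) - dt g t x ^+ 2).

(** The summands on the left are the values found by [is_derive_momentum] and [is_derive_flux]. Each
    contributes one mixed derivative with coefficient [- v]; symmetry merges them into the term with
    coefficient 2. *)
Lemma euler_lagrange_diffeo_operator (rho : R -> R) (g : R -> R -> R) (c t x : R) :
  Ck 2 (spacetime c) g -> 0 < t < c -> (forall y, 0 < dx g t y) ->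
  (forall y, 0 < rho y) ->
  let r := rho x in let v := dt g t x in let w := dx g t x in
  r ^+ 2 * (dt (dt g) t x / w - v * dt (dx g) t x / w ^+ 2) +
  (derive1 p (r / w) * (r / w) * (derive1 rho x / w - r * dx (dx g) t x / w ^+ 2)
     - (r * v / w)
       * ((derive1 rho x * v + r * dx (dt g) t x) / w - r * v * dx (dx g) t x / w ^+ 2))
  = (r / w) ^+ 2 * diffeo_operator rho g t x.
Proof.
move=> Cg tc w0 r0 r v w; rewrite (mixed_partials_commute _ _ _ _ Cg tc) /diffeo_operator.
rewrite -/r -/v -/w.
have wn0 : w != 0 by rewrite gt_eqF// w0.
have rn0 : r != 0 by rewrite gt_eqF// r0.
move: (dt (dt g) t x) (dx (dt g) t x) (dx (dx g) t x) (derive1 p (r / w)) (derive1 rho x).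
move=> a1 a2 a3 a4 a5; clearbody r v w.
by field; rewrite ?wn0 ?rn0.
Qed.

End euler_lagrange.

(** * Smooth bump functions *)

Section smooth_functions_of_one_variable.
Context {R : realType}.
Implicit Types (f g u : R -> R) (q : {poly R}).

(** The recursion mirrors that of [Ck], so that products of functions of [t] and of [x] are handled
    by induction on [k]. *)
Fixpoint Ck_line (k : nat) f : Prop :=
  continuous f /\
  match k with
  | 0 => True
  | k'.+1 => (forall x, derivable f x 1) /\ Ck_line k' f^`()
  end.

Lemma Ck_line_continuous k f : Ck_line k f -> continuous f.
Proof. by case: k => [|k] []. Qed.

Lemma Ck_lineS k f df : (forall x, is_derive x (1 : R) f (df x)) ->
  Ck_line k df -> Ck_line k.+1 f.
Proof.
move=> dfE cdf; split; first by move=> x; exact: is_derive_continuous (dfE x).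
split; first by move=> x; exact: is_derive_derivable (dfE x).
by rewrite (_ : f^`() = df)//; apply/funext => x; exact: is_derive_derive1.
Qed.

Lemma Ck_line_is_derive k f x : Ck_line k.+1 f -> is_derive x (1 : R) f (f^`() x).
Proof. by case=> _ [df _]; exact: derivable_is_derive1. Qed.

Lemma Ck_line_derive1 k f : Ck_line k.+1 f -> Ck_line k f^`().
Proof. by case=> _ []. Qed.

Lemma Ck_line_pred k f : Ck_line k.+1 f -> Ck_line k f.
Proof.
elim: k f => [|k IH] f Cf; first by split=> //; exact: Ck_line_continuous Cf.
apply: (@Ck_lineS _ _ f^`()) => [x|]; first exact: Ck_line_is_derive Cf.
by apply: IH; exact: Ck_line_derive1 Cf.
Qed.

Lemma Ck_line_add k f g : Ck_line k f -> Ck_line k g ->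
  Ck_line k (fun x => f x + g x).
Proof.
elim: k f g => [|k IH] f g Cf Cg.
  by split=> // x; apply: cvgD; [exact: Ck_line_continuous Cf x|exact: Ck_line_continuous Cg x].
apply: (Ck_lineS k (fun x => f x + g x) (fun x => derive1 f x + derive1 g x)) => [x|].
  by apply: is_derive_add; [exact: Ck_line_is_derive Cf|exact: Ck_line_is_derive Cg].
by apply: IH; [exact: Ck_line_derive1 Cf|exact: Ck_line_derive1 Cg].
Qed.

Lemma Ck_line_mul k f g : Ck_line k f -> Ck_line k g ->
  Ck_line k (fun x => f x * g x).
Proof.
elim: k f g => [|k IH] f g Cf Cg.
  by split=> // x; apply: cvgM; [exact: Ck_line_continuous Cf x|exact: Ck_line_continuous Cg x].
apply: (Ck_lineS k (fun x => f x * g x)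
  (fun x => derive1 f x * g x + f x * derive1 g x)) => [x|].
  by apply: is_derive_mul; [exact: Ck_line_is_derive Cf|exact: Ck_line_is_derive Cg].
apply: Ck_line_add; apply: IH.
- exact: Ck_line_derive1 Cf.
- exact: Ck_line_pred Cg.
- exact: Ck_line_pred Cf.
- exact: Ck_line_derive1 Cg.
Qed.

Lemma Ck_line_comp k f u : Ck_line k f -> Ck_line k u ->
  Ck_line k (fun x => f (u x)).
Proof.
elim: k f u => [|k IH] f u Cf Cu.
  split=> // x; apply: (@continuous_comp _ _ _ u f).
    exact: Ck_line_continuous Cu x.
  exact: Ck_line_continuous Cf (u x).
apply: (Ck_lineS k (fun x => f (u x)) (fun x => derive1 f (u x) * derive1 u x)) => [x|].
  by apply: is_derive_comp; [exact: Ck_line_is_derive Cu|exact: Ck_line_is_derive Cf].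
apply: Ck_line_mul; last exact: Ck_line_derive1 Cu.
by apply: IH; [exact: Ck_line_derive1 Cf|exact: Ck_line_pred Cu].
Qed.

Lemma is_derive_horner q x : is_derive x (1 : R) (horner q) (deriv q).[x].
Proof.
rewrite (_ : (deriv q).[x] = (horner q)^`()%classic x); last by rewrite -derivE.
by apply: derivable_is_derive1; exact: derivable_horner.
Qed.

Lemma Ck_line_horner k q : Ck_line k (horner q).
Proof.
elim: k q => [|k IH] q; first by split=> //; exact: continuous_horner.
by apply: Ck_lineS (IH (deriv q)) => x; exact: is_derive_horner.
Qed.

(** The coefficients are arbitrary so that the family is closed under differentiation and the
    induction on [k] goes through. *)
Lemma Ck_line_cos_sin k (w x0 a b d : R) :
  Ck_line k (fun x => a * cos (w * (x - x0)) + b * sin (w * (x - x0)) + d).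
Proof.
have D a' b' d' x : is_derive x (1 : R)
    (fun x => a' * cos (w * (x - x0)) + b' * sin (w * (x - x0)) + d')
    ((w * b') * cos (w * (x - x0)) + (- w * a') * sin (w * (x - x0)) + 0).
  have Du : is_derive x (1 : R) (fun x => w * (x - x0)) w.
    have := is_derive_mul _ _ _ _ _ (is_derive_cst w x (1 : R)) (is_derive_add _ _ _ _ _
      (is_derive_id x (1 : R)) (is_derive_cst (- x0) x (1 : R))).
    by rewrite addr0 mulr1 mul0r add0r.
  have Dc := is_derive_comp _ _ _ _ _ Du (is_derive_cos (w * (x - x0))).
  have Ds := is_derive_comp _ _ _ _ _ Du (is_derive_sin (w * (x - x0))).
  have := is_derive_add _ _ _ _ _ (is_derive_add _ _ _ _ _
    (is_derive_mul _ _ _ _ _ (is_derive_cst a' x (1 : R)) Dc)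
    (is_derive_mul _ _ _ _ _ (is_derive_cst b' x (1 : R)) Ds)) (is_derive_cst d' x (1 : R)).
  by move/is_derive_eq; apply => /=; ring.
elim: k a b d => [|k IH] a b d.
  by split=> // x; exact: is_derive_continuous (D a b d x).
exact: Ck_lineS (D a b d) (IH _ _ _).
Qed.

(* For [q = 1] this is the classical smooth function [exp (-1/x)] vanishing on
   the nonpositive half-line; the general [q] makes the class closed under
   differentiation. *)
Definition flat q (x : R) : R :=
  if 0 < x then q.[x^-1] * expR (- x^-1) else 0.

(** Induction on [q] by Horner's scheme: in [q * 'X + a] the factor ['X] is absorbed into the power,
    which is why [m] varies. The remaining constant term uses [y ^+ m * expR (- y) <= m!], from one
    term of the exponential series. *)
Lemma expR_dominates_horner q m : exists2 C, 0 <= C &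
  forall y : R, 0 <= y -> `|q.[y]| * y ^+ m * expR (- y) <= C.
Proof.
elim/poly_ind: q m => [|q a IH] m.
  by exists 0 => // y _; rewrite horner0 normr0 !mul0r.
have [C C0 HC] := IH m.+1.
exists (C + `|a| * m`!%:R); first by rewrite addr_ge0// mulr_ge0.
move=> y y0; rewrite hornerMXaddC.
have ym : y ^+ m * expR (- y) <= m`!%:R.
  rewrite expRN ler_pdivrMr ?expR_gt0// -ler_pdivrMl ?ltr0n ?fact_gt0// mulrC.
  case: m {HC} => [|m]; first by rewrite expr0 fact0 invr1 mulr1 -expR0 ler_expR.
  by have := expR_ge1Dxn m y0; apply: le_trans; rewrite lerDr.
apply: (@le_trans _ _ ((`|q.[y]| * y + `|a|) * (y ^+ m * expR (- y)))).
  rewrite -mulrA ler_wpM2r ?mulr_ge0 ?exprn_ge0 ?expR_ge0//.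
  by rewrite (le_trans (ler_normD _ _))// normrM (ger0_norm y0).
rewrite mulrDl lerD//; last by rewrite ler_wpM2l.
by have := HC y y0; rewrite exprS !mulrA.
Qed.

(** For [x > 0] the factor ['X^2] comes from the derivative of [x^-1]. At [0] the derivative
    vanishes because [flat q] is bounded by a multiple of the square. *)
Lemma is_derive_flat q x :
  is_derive x (1 : R) (flat q) (flat ('X^2 * (q - deriv q)) x).
Proof.
have [x0|x0|->] := ltgtP x 0.
- rewrite {2}/flat ltNge ltW//=.
  apply: (@near_eq_is_derive _ _ _ (cst 0)).
  near=> y; rewrite /flat ltNge ltW//.
  by near: y; exact: lt_nbhsl.
- rewrite {2}/flat x0.
  pose h (y : R) := q.[y^-1] * expR (- y^-1).
  apply: (@near_eq_is_derive _ _ _ h).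
    near=> y; rewrite /flat /h ifT//.
    by near: y; exact: lt_nbhsr.
  have xn0 : x != 0 by rewrite gt_eqF.
  have Di := is_derive_inv id x 1 xn0 (is_derive_id x 1).
  have Dq := is_derive_comp _ _ _ _ _ Di (is_derive_horner q x^-1).
  have De := is_derive_comp _ _ _ _ _ (is_derive_opp _ _ _ Di) (is_derive_expR (- x^-1)).
  have := is_derive_mul _ _ _ _ _ Dq De.
  move/is_derive_eq; apply; rewrite !hornerE /=.
  by field.
- rewrite {2}/flat ltxx.
  (* The power 2, read at [y^-1], gives a bound by [C * y ^+ 2]: one factor is spent on the
     difference quotient and the other makes it tend to zero. *)
  have [C C0 HC] := expR_dominates_horner q 2.
  have flat_le y : `|flat q y| <= C * y ^+ 2.
    rewrite /flat; case: ifPn => [y0|_]; last by rewrite normr0 mulr_ge0// sqr_ge0.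
    have := HC y^-1; rewrite invr_ge0 ltW// => /(_ isT).
    rewrite normrM (ger0_norm (expR_ge0 _)) exprVn.
    by rewrite mulrAC ler_pdivrMr// exprn_gt0.
  apply/is_derive1_caratheodory; exists (fun z => flat q z / z).
  have flat00 : flat q 0 = 0 by rewrite /flat ltxx.
  split; last by rewrite flat00 mul0r.
    move=> z; rewrite flat00 !subr0; have [->|z0] := eqVneq z 0.
      by rewrite flat00 mulr0.
    by rewrite divfK.
  apply/cvgrPdist_le => e e0; near=> h.
  have [->|hn0] := eqVneq h 0; first by rewrite subrr normr0 ltW.
  rewrite flat00 mul0r sub0r normrN normrM normfV ler_pdivrMr ?normr_gt0//.
  rewrite (le_trans (flat_le _))// -real_normK ?num_real// expr2 mulrA ler_wpM2r//.
  (* [C] may be zero, so [C + 1] is used as a divisor. *)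
  rewrite (@le_trans _ _ ((C + 1) * `|h|))// ?ler_wpM2r// ?lerDl//.
  rewrite -ler_pdivlMl ?ltr_wpDl//.
  near: h; apply/nbhs_ballP; exists ((C + 1)^-1 * e) => /=.
    by rewrite mulr_gt0// invr_gt0 ltr_wpDl.
  by move=> z; rewrite /ball/= sub0r normrN => /ltW.
Unshelve. all: by end_near. Qed.

Lemma Ck_line_flat k q : Ck_line k (flat q).
Proof.
elim: k q => [|k IH] q.
  by split=> // x; exact: is_derive_continuous (is_derive_flat q x).
exact: Ck_lineS (is_derive_flat q) (IH _).
Qed.

Lemma flat1_ge0 x : 0 <= flat 1 x.
Proof. by rewrite /flat; case: ifP => // _; rewrite hornerC mul1r expR_ge0. Qed.

Lemma flat1_gt0 x : 0 < x -> 0 < flat 1 x.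
Proof. by move=> x0; rewrite /flat x0 hornerC mul1r expR_gt0. Qed.

Lemma flat1_neq0 x : flat 1 x != 0 -> 0 < x.
Proof. by rewrite /flat; case: ifP => // _; rewrite eqxx. Qed.

End smooth_functions_of_one_variable.

(** * Bumps on the line, on the circle and on spacetime *)

Section bump_functions.
Context {R : realType}.

(** [flat 1] is composed with the polynomial [d ^+ 2 - (x - x0) ^+ 2], positive exactly within [d]
    of [x0]. *)
Lemma line_bump (x0 d : R) : 0 < d -> exists f : R -> R,
  [/\ forall k, Ck_line k f, forall x, 0 <= f x, 0 < f x0 &
      forall x, f x != 0 -> `|x - x0| < d].
Proof.
move=> d0; pose q : {poly R} := (d ^+ 2)%:P - ('X - x0%:P) ^+ 2.
have qE x : q.[x] = d ^+ 2 - (x - x0) ^+ 2 by rewrite !hornerE.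
exists (fun x => flat 1 q.[x]); split.
- by move=> k; apply: Ck_line_comp; [exact: Ck_line_flat|exact: Ck_line_horner].
- by move=> x; exact: flat1_ge0.
- by apply: flat1_gt0; rewrite qE subrr expr0n subr0 exprn_gt0.
- move=> x /flat1_neq0; rewrite qE subr_gt0 -(real_normK (num_real (x - x0))).
  by rewrite ltr_sqr ?nnegrE// ltW.
Qed.

Lemma function_on_circle_shift (l : {posnum R}) (f : R -> R) (n : int) x :
  function_on (Circle l) f -> f (x - n%:~R * l%:num) = f x.
Proof.
move=> /= fl.
have shiftn (m : nat) y : f (y + m%:R * l%:num) = f y.
  elim: m y => [|m IH] y; first by rewrite mul0r addr0.
  by rewrite -natr1 mulrDl mul1r addrA fl IH.
case: n => m; last by rewrite NegzE mulrNz mulNr opprK shiftn.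
by rewrite -[LHS](shiftn m) subrK.
Qed.

(** Here [flat 1] is composed with [cos (w * (x - x0)) - cos (w * e)], which has period [l] and is
    positive only near the translates of [x0]. *)
Lemma circle_bump (l : {posnum R}) (x0 d : R) : 0 < d -> exists f : R -> R,
  [/\ forall k, Ck_line k f, forall x, 0 <= f x, 0 < f x0, function_on (Circle l) f &
      forall x, f x != 0 -> exists n : int, `|x - n%:~R * l%:num - x0| < d].
Proof.
move=> d0; pose L := l%:num; have L0 : 0 < L by rewrite /L gt0.
(* The bound [L / 4] keeps the angle [w * e] in [[0, pi]], where the cosine is decreasing. *)
pose e := Num.min d (L / 4).
have e0 : 0 < e by rewrite lt_min d0 divr_gt0.
have [ed eL] : e <= d /\ e <= L / 4 by rewrite !ge_min !lexx orbT.
have pi0 : 0 < (pi : R) := pi_gt0 R.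
pose w := 2 * pi / L; have w0 : 0 < w by rewrite divr_gt0// mulr_gt0.
have wL : w * L = pi *+ 2 by rewrite /w divfK ?gt_eqF// mulr_natl.
pose u x := cos (w * (x - x0)) - cos (w * e).
have ul : function_on (Circle l) u.
  move=> x; rewrite /u (_ : w * (x + l%:num - x0) = w * (x - x0) + pi *+ 2).
    by rewrite cosD2pi.
  by rewrite -wL /L; ring.
have web : 0 <= w * e <= pi.
  apply/andP; split; first by rewrite ltW// mulr_gt0.
  apply: (@le_trans _ _ (w * L / 4)); first by rewrite -mulrA ler_wpM2l// ltW.
  by rewrite wL; lra.
exists (fun x => flat 1 (u x)); split.
- move=> k; apply: Ck_line_comp; first exact: Ck_line_flat.
  have := Ck_line_cos_sin k w x0 1 0 (- cos (w * e)).
  by under eq_fun do rewrite mul1r mul0r addr0.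
- by move=> x; exact: flat1_ge0.
- apply: flat1_gt0; rewrite /u subrr mulr0 subr_gt0 ltr_cos ?in_itv//=.
    by rewrite mulr_gt0.
  by rewrite lexx ltW.
- by move=> x; rewrite ul.
- move=> x /flat1_neq0 ux0.
  (* Rounding to the nearest integer puts the translate [y] within half a period of [x0], so that
     its angle also lies in [[0, pi]]. *)
  pose n := Num.floor ((x - x0) / L + 2^-1).
  exists n; apply: lt_le_trans ed.
  set y := x - n%:~R * l%:num.
  have : 0 < u y by rewrite /y function_on_circle_shift.
  have ny : `|y - x0| <= L / 2.
    have := floor_itv ((x - x0) / L + 2^-1).
    rewrite -/n intrD1 => /andP[H1 H2].
    have E : (x - x0) = (x - x0) / L * L by rewrite divfK ?gt_eqF.
    have yE : y - x0 = ((x - x0) / L - n%:~R) * L.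
      by rewrite mulrBl -E /y -/L; ring.
    rewrite yE normrM (gtr0_norm L0) mulrC ler_wpM2l ?(ltW L0)//.
    by rewrite ler_norml; apply/andP; split; lra.
  rewrite /u subr_gt0 -[cos (w * (y - x0))]cos_norm normrM (gtr0_norm w0) ltr_cos ?in_itv//=.
    by rewrite ltr_pM2l.
  apply/andP; split; first by rewrite mulr_ge0// ltW.
  apply: (@le_trans _ _ (w * (L / 2))); first by rewrite ler_wpM2l// ltW.
  by rewrite mulrA wL; lra.
Qed.

(** The condition that [y] and [x] are not separated by functions on [M] says that they are the same
    point of [M], for the line and the circle alike. *)
Lemma bump_on (M : manifold1 R) (x0 d : R) : 0 < d -> exists f : R -> R,
  [/\ forall k, Ck_line k f, forall x, 0 <= f x, 0 < f x0, function_on M f &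
      forall x, f x != 0 -> exists2 y, `|y - x0| < d &
        forall h, function_on M h -> h y = h x].
Proof.
move=> d0; case: M => [|l].
  have [f [Cf f0 fx0 fd]] := line_bump x0 d d0.
  by exists f; split => // x /fd xd; exists x.
have [f [Cf f0 fx0 fl fd]] := circle_bump l x0 d d0.
exists f; split => // x /fd[n xn]; exists (x - n%:~R * l%:num) => // h.
exact: function_on_circle_shift.
Qed.

(** Each partial derivative of a product [f t * g x] is again such a product, with one factor
    differentiated. *)
Lemma smooth2_tensor (D : set (R * R)) (f g : R -> R) :
  (forall k, Ck_line k f) -> (forall k, Ck_line k g) ->
  smooth2 D (fun t x => f t * g x).
Proof.
move=> Cf Cg k; have := Cf k; have := Cg k; clear Cf Cg.
have cont (f' g' : R -> R) z : continuous f' -> continuous g' ->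
    {for z, continuous (fun w : R * R => f' w.1 * g' w.2)}.
  move=> cf cg; apply: cvgM.
    by apply: (@continuous_comp _ _ _ fst f'); [exact: cvg_fst|exact: cf].
  by apply: (@continuous_comp _ _ _ snd g'); [exact: cvg_snd|exact: cg].
elim: k f g => [|k IH] f g Cg Cf.
  by split=> // z _; apply: cont; [exact: Ck_line_continuous Cf|exact: Ck_line_continuous Cg].
split.
  by move=> z _; apply: cont; [exact: Ck_line_continuous Cf|exact: Ck_line_continuous Cg].
have Dt (t x : R) : is_derive t (1 : R) (fun s => f s * g x) (derive1 f t * g x).
  have := is_derive_mul _ _ _ _ _ (Ck_line_is_derive _ _ t Cf) (is_derive_cst (g x) t (1 : R)).
  by rewrite mulr0 addr0.
have Dx (t x : R) : is_derive x (1 : R) (fun y => f t * g y) (f t * derive1 g x).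
  have := is_derive_mul _ _ _ _ _ (is_derive_cst (f t) x (1 : R)) (Ck_line_is_derive _ _ x Cg).
  by rewrite mul0r add0r.
split.
- by move=> z _; exact: is_derive_derivable (Dt _ _).
- by move=> z _; exact: is_derive_derivable (Dx _ _).
- rewrite (_ : dt _ = fun t x => derive1 f t * g x).
    by apply: IH; [exact: Ck_line_pred Cg|exact: Ck_line_derive1 Cf].
  by apply/funext => t; apply/funext => x; exact: is_derive_derive1.
- rewrite (_ : dx _ = fun t x => f t * derive1 g x).
    by apply: IH; [exact: Ck_line_derive1 Cg|exact: Ck_line_pred Cf].
  by apply/funext => t; apply/funext => x; exact: is_derive_derive1.
Qed.

Lemma closed_setX (T U : topologicalType) (A : set T) (B : set U) :
  closed A -> closed B -> closed (A `*` B).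
Proof.
move=> cA cB; have -> : A `*` B = fst @^-1` A `&` snd @^-1` B by apply/seteqP; split.
by apply: closedI; apply: closed_comp => // z _; [exact: cvg_fst|exact: cvg_snd].
Qed.

Lemma closure_fundamental_domain_circle (l : {posnum R}) :
  closure (fundamental_domain (Circle l)) `<=` `[0, l%:num].
Proof.
apply: (subset_trans (closure_subset (B := `[0, l%:num]) _)).
  exact: subset_itv_co_cc.
by have /closure_id <- := @itv_closed _ R 0 l%:num.
Qed.

Lemma test_function_bump (M : manifold1 R) (c t0 x0 d : R) :
  0 < t0 < c -> 0 < d -> exists zeta,
  [/\ test_function M c zeta, forall t x, 0 <= zeta t x, 0 < zeta t0 x0 &
      forall t x, zeta t x != 0 -> [/\ 0 < t < c, `|t - t0| < d & exists2 y,
        `|y - x0| < d & forall h, function_on M h -> h y = h x]].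
Proof.
move=> /andP[t00 t0c] d0.
(* Halving the minimum puts the closed segment [[t0 - e, t0 + e]] inside the open interval of
   times. *)
pose e := Num.min d (Num.min t0 (c - t0)) / 2.
have m0 : 0 < Num.min d (Num.min t0 (c - t0)) by rewrite !lt_min d0 t00 subr_gt0.
have e0 : 0 < e by rewrite divr_gt0.
have : e < Num.min d (Num.min t0 (c - t0)) by rewrite ltr_pdivrMr// ltr_pMr// ltr1n.
rewrite !lt_min => /andP[ed /andP[et0 ec]].
have [f [Cf f0 ft0 fd]] := line_bump t0 e e0.
have [g [Cg g0 gx0 gM gd]] := bump_on M x0 d d0.
exists (fun t x => f t * g x).
have supp_sub (J : set R) : closed J -> (forall t x, f t * g x != 0 -> J x) ->
    supp (fun t x => f t * g x) `<=` `[t0 - e, t0 + e] `*` J.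
  move=> cJ fgJ.
  have cl : closed (`[t0 - e, t0 + e] `*` J) by apply: closed_setX => //; exact: itv_closed.
  rewrite /supp [X in _ `<=` X](closure_id _).1//; apply: closure_subset.
  move=> [t x] /= fg0; split => /=; last exact: fgJ fg0.
  move: fg0; rewrite mulf_eq0 negb_or => /andP[/fd + _].
  by rewrite ltr_distl in_itv/= => /andP[? ?]; rewrite !ltW.
have suppE : supp (fun t x => f t * g x) `<=` `[t0 - e, t0 + e] `*` setT.
  by apply: supp_sub => //; exact: closedT.
split.
- split.
  + exact: smooth2_tensor.
  + case: M gM {gd} => //= l gl t x; by rewrite gl.
  + move=> [t x] /suppE[/= + _]; rewrite in_itv/= => /andP[? ?].
    by split => //=; rewrite in_itv/=; apply/andP; split; lra.
  + have csupp : closed (supp (fun t x => f t * g x) `&` (setT `*` closure (fundamental_domain M))).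
      apply: closedI; first exact: closed_closure.
      by apply: closed_setX; [exact: closedT|exact: closed_closure].
    case: M gM gd csupp => [|l] gM gd csupp.
      apply: (subclosed_compact csupp
        (compact_setX (@segment_compact R (t0 - e) (t0 + e))
          (@segment_compact R (x0 - d) (x0 + d)))).
      move=> z [+ _]; apply: supp_sub; first exact: itv_closed.
      move=> t x; rewrite mulf_eq0 negb_or => /andP[_ /gd[y]].
      (* On the line every function is a function on [M]; the identity gives [y = x]. *)
      rewrite ltr_distl => /andP[y1 y2] /(_ id I) /= yx.
      by rewrite in_itv/= -yx !ltW.
    apply: (subclosed_compact csupp
      (compact_setX (@segment_compact R (t0 - e) (t0 + e)) (@segment_compact R 0 l%:num))).
    move=> z [/suppE[z1 _] [_ z2]]; split => //.
    exact: closure_fundamental_domain_circle.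
- by move=> t x; rewrite mulr_ge0.
- by rewrite mulr_gt0.
- move=> t x; rewrite mulf_eq0 negb_or => /andP[/fd te /gd gy].
  split=> //; last exact: lt_trans ed.
  by move: te; rewrite ltr_distl => /andP[? ?]; apply/andP; split; lra.
Qed.

End bump_functions.

(** * Supports of test functions *)

(** The region over which [varied_action] integrates, as one subset of the plane. *)
Definition supp_domain {R : realType} (M : manifold1 R) (c : R) (zeta : R -> R -> R) :
  set (R * R) := supp zeta `&` (`]0, c[ `*` fundamental_domain M).

Lemma fundamental_domain_measurable {R : realType} (M : manifold1 R) :
  measurable (fundamental_domain M : set (measurableTypeR R)).
Proof. by case: M => [|l] /=; [exact: measurableT|exact: measurable_itv]. Qed.

Lemma supp_domain_measurable {R : realType} (M : manifold1 R) c (zeta : R -> R -> R) :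
  measurable (supp_domain M c zeta).
Proof.
apply: measurableI; last by apply: measurableX => //; exact: fundamental_domain_measurable.
rewrite -[supp zeta]setCK; apply: measurableC; apply: open_prod_measurable.
exact: closed_openC (@closed_closure _ _).
Qed.

Section test_functions.
Context {R : realType}.
Variables (M : manifold1 R) (c : R) (zeta : R -> R -> R).
Hypothesis zeta_test : test_function M c zeta.

Lemma test_function_Ck k : Ck k (spacetime c) zeta.
Proof. by have [sz _ _ _] := zeta_test; exact: sz. Qed.

Lemma supp_spacetime t x : supp zeta (t, x) -> 0 < t < c.
Proof. by have [_ _ sz _] := zeta_test; move=> /sz /spacetimeE. Qed.

(** The support is closed, so [zeta] vanishes on a whole neighbourhood of the point, which also
    kills its derivatives there. *)
Lemma notin_supp t x : ~ supp zeta (t, x) ->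
  [/\ zeta t x = 0, dt zeta t x = 0 & dx zeta t x = 0].
Proof.
move=> ntx.
have [d /= d0 dz] : exists2 d : R, 0 < d & forall s y, `|t - s| < d -> `|x - y| < d ->
    zeta s y = 0.
  have : nbhs (t, x) (~` supp zeta).
    by apply: open_nbhs_nbhs; split => //; exact: closed_openC (@closed_closure _ _).
  move=> /nbhs_ballP[d /= d0 dz]; exists d => // s y ts xy; apply/eqP.
  apply: contrapT => /negP z0; apply: (dz (s, y)); first by split.
  exact: subset_closure.
split; first by apply: dz; rewrite subrr normr0.
- apply: is_derive_derive1; apply: (@near_eq_is_derive _ _ _ (cst 0)).
  by apply/nbhs_ballP; exists d => //= s ts; rewrite dz ?subrr ?normr0.
- apply: is_derive_derive1; apply: (@near_eq_is_derive _ _ _ (cst 0)).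
  by apply/nbhs_ballP; exists d => //= y xy; rewrite dz ?subrr ?normr0.
Qed.

Lemma continuous_pair_fst {T U V : topologicalType} (f : T * U -> V) t x :
  {for (t, x), continuous f} -> {for t, continuous (fun s => f (s, x))}.
Proof.
move=> cf; apply: (@continuous_comp _ _ _ (fun s => (s, x)) f) => //.
by apply: cvg_pair => /=; [exact: cvg_id|exact: cvg_cst].
Qed.

Lemma continuous_pair_snd {T U V : topologicalType} (f : T * U -> V) t x :
  {for (t, x), continuous f} -> {for x, continuous (fun y => f (t, y))}.
Proof.
move=> cf; apply: (@continuous_comp _ _ _ (fun y => (t, y)) f) => //.
by apply: cvg_pair => /=; [exact: cvg_cst|exact: cvg_id].
Qed.

(* On the line the box encloses the support; on the circle it is one period, and
   the boundary values in [x] agree instead of vanishing. *)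
Lemma test_function_box : 0 < c -> exists a b x0 x1,
  [/\ [/\ 0 < a, a < b, b < c & x0 < x1],
      supp_domain M c zeta `<=` `[a, b] `*` `[x0, x1[,
      forall t x, a <= t <= b -> x0 <= x < x1 -> supp zeta (t, x) -> supp_domain M c zeta (t, x),
      forall x, x0 <= x < x1 -> zeta a x = 0 /\ zeta b x = 0 &
      forall t h, 0 < t < c -> function_on M h -> h x1 * zeta t x1 = h x0 * zeta t x0].
Proof.
move=> c0; have [_ zM sz cK] := zeta_test.
set K := supp zeta `&` _ in cK.
have KD z : K z -> 0 < z.1 < c by case: z => t x [/sz /spacetimeE].
(* Bounds on [1 / t] and [1 / (c - t)] over the compact set [K] keep its times away from [0] and
   from [c]. *)
have [C1 H1] : exists C, forall z, K z -> `|z.1^-1| <= C.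
  apply: continuous_on_compact_bounded => // z /KD/andP[z0 _].
  by apply: cvgV; [rewrite gt_eqF|exact: cvg_fst].
have [C2 H2] : exists C, forall z, K z -> `|(c - z.1)^-1| <= C.
  apply: continuous_on_compact_bounded => // z /KD/andP[_ zc].
  apply: cvgV; first by rewrite gt_eqF// subr_gt0.
  by apply: cvgB; [exact: cvg_cst|exact: cvg_fst].
have [C3 H3] : exists C, forall z, K z -> `|z.2| <= C.
  have c2 (z : R * R) : {for z, continuous snd} by exact: cvg_snd.
  exact: (continuous_on_compact_bounded K snd cK (fun z _ => c2 z)).
(* The times of [K] lie strictly between [m^-1] and [c - m^-1]. The summand [4 / c] makes this
   strict and gives [m^-1 <= c / 4], so that the two ends are in order. *)
pose m := `|C1| + `|C2| + 4 / c.
have c40 : 0 < 4 / c by rewrite divr_gt0.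
have m4c : 4 / c <= m by rewrite lerDr addr_ge0.
have m0 : 0 < m by exact: lt_le_trans m4c.
have a4 : m^-1 <= c / 4.
  by rewrite -[leRHS]invrK lef_pV2 ?posrE ?invr_gt0 ?divr_gt0// invf_div.
have ia0 : 0 < m^-1 by rewrite invr_gt0.
have Kab z : K z -> m^-1 < z.1 /\ z.1 < c - m^-1.
  move=> Kz; have /andP[z0 zc] := KD z Kz.
  have cz0 : 0 < c - z.1 by rewrite subr_gt0.
  have := H1 z Kz; have := H2 z Kz; rewrite !gtr0_norm ?invr_gt0// => h2 h1.
  have n1 := ler_norm C1; have n2 := ler_norm C2.
  have p1 := normr_ge0 C1; have p2 := normr_ge0 C2.
  split.
    by rewrite -[ltRHS]invrK ltf_pV2 ?posrE ?invr_gt0// /m; lra.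
  rewrite ltrBrDl -ltrBrDr -[ltRHS]invrK ltf_pV2 ?posrE ?invr_gt0// /m; lra.
pose N := `|C3| + 1.
have KN z : K z -> - N < z.2 /\ z.2 < N.
  move=> /H3 h3; apply/andP; rewrite -ltr_norml (le_lt_trans h3)//.
  by rewrite /N (le_lt_trans (ler_norm _))// ltrDl.
have N0 : 0 < N by rewrite /N ltr_wpDl.
have notK t x : ~ K (t, x) -> closure (fundamental_domain M) x -> zeta t x = 0.
  move=> nK cx; apply/eqP; apply: contrapT => /negP z0; apply: nK; split => //.
  exact: subset_closure.
have ab0 : forall x, fundamental_domain M x -> zeta m^-1 x = 0 /\ zeta (c - m^-1) x = 0.
  move=> x Fx; split; apply: notK; try exact: subset_closure.
    by move=> /Kab[/= + _]; rewrite ltxx.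
  by move=> /Kab[/= _]; rewrite ltxx.
have SK z : supp_domain M c zeta z -> K z.
  by move=> [? [_ ?]]; split => //; split => //; exact: subset_closure.
have base : [/\ 0 < m^-1, m^-1 < c - m^-1 & c - m^-1 < c].
  by split => //; lra.
have S1 z : supp_domain M c zeta z -> `[m^-1, c - m^-1] z.1.
  by move=> /SK/Kab[? ?]; rewrite /= in_itv/= !ltW.
have inS t x : m^-1 <= t <= c - m^-1 -> fundamental_domain M x -> supp zeta (t, x) ->
    supp_domain M c zeta (t, x).
  move=> /andP[t1 t2] Fx sx; split => //; split => //=.
  by rewrite in_itv/=; apply/andP; split; lra.
case: base => b1 b2 b3.
exists m^-1, (c - m^-1); move: M zM @K cK {KD H1 H2 H3} Kab KN notK ab0 SK S1 inS.
case=> [|l] zM K cK Kab KN notK ab0 SK S1 inS.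
  exists (- N), N; split.
  - by split => //; lra.
  - move=> z Sz; split; first exact: S1.
    by have [? ?] := KN _ (SK _ Sz); rewrite /= in_itv/= ltW.
  - by move=> t x tab _; exact: inS.
  - by move=> x _; exact: ab0.
  - move=> t h _ _; rewrite !notK ?mulr0//.
    + by move=> /KN[/= + _]; rewrite ltxx.
    + exact: subset_closure.
    + by move=> /KN[/= _]; rewrite ltxx.
    + exact: subset_closure.
exists 0, l%:num; split.
- by split.
- move=> z Sz; split; first exact: S1.
  by case: Sz => _ [].
- by move=> t x tab xl; apply: inS => //=; rewrite in_itv.
- by move=> x xl; apply: ab0; rewrite /= in_itv.
- by move=> t h tc hl; have := hl 0; have := zM t 0; rewrite !add0r => -> ->.
Qed.

End test_functions.

(** * Integration by parts on spacetime *)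

Section integration_on_spacetime.
Context {R : realType}.
Local Notation mu := (@lebesgue_measure R).
Implicit Types (f : R -> R) (h : R -> R -> R).

Definition continuous_on_spacetime (c : R) h :=
  forall t x, 0 < t < c -> {for (t, x), continuous (fun w : R * R => h w.1 w.2)}.

Lemma spacetime_integrable c h a b x0 x1 (S : set (R * R)) :
  0 < a -> b < c -> measurable S -> S `<=` `[a, b] `*` `[x0, x1] ->
  continuous_on_spacetime c h ->
  [/\ measurable_fun S (fun z => h z.1 z.2),
      exists C, forall z, S z -> `|h z.1 z.2| <= C &
      (mu \x mu)%E.-integrable S (EFin \o (fun z => h z.1 z.2))].
Proof.
move=> a0 bc mS SB ch.
have cz z : (`[a, b] `*` `[x0, x1]) z -> {for z, continuous (fun z : R * R => h z.1 z.2)}.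
  case: z => t x [/= + _]; rewrite in_itv/= => /andP[at_ tb]; apply: ch.
  by rewrite (lt_le_trans a0)// (le_lt_trans tb).
have [C HC] := continuous_on_compact_bounded _ _
  (compact_setX (@segment_compact R a b) (@segment_compact R x0 x1)) cz.
have mh : measurable_fun S (fun z => h z.1 z.2).
  by apply: continuous_on_prod_measurable => // z /SB; exact: cz.
have hC z : S z -> `|h z.1 z.2| <= C by move=> /SB; exact: HC.
by split => //; [exists C|exact: (bounded_prod_integrable a b x0 x1 C)].
Qed.

Lemma Rintegral_derivative f df (a b : R) : a < b ->
  (forall x, a <= x <= b -> is_derive x (1 : R) f (df x)) ->
  (forall x, a <= x <= b -> {for x, continuous df}) ->
  \int[mu]_(x in `[a, b]) df x = f b - f a.
Proof.
move=> ab dfE cdf; rewrite /Rintegral (@continuous_FTC2 R df f a b)//.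
- by apply: continuous_in_subspaceT => x; rewrite inE/= in_itv/=; exact: cdf.
- have cf x : a <= x <= b -> {for x, continuous f}.
    by move=> /dfE; exact: is_derive_continuous.
  split.
  + move=> x; rewrite in_itv/= => /andP[ax xb].
    by apply: is_derive_derivable (dfE x _); rewrite !ltW.
  + by apply: cvg_at_right_filter; apply: cf; rewrite lexx ltW.
  + by apply: cvg_at_left_filter; apply: cf; rewrite lexx ltW.
- move=> x; rewrite in_itv/= => /andP[ax xb].
  by apply: is_derive_derive1; apply: dfE; rewrite !ltW.
Qed.

Lemma Rintegral_vanishing_outside (d : measure_display) (T : measurableType d)
    (m : {measure set T -> \bar R}) (S B : set T) (g : T -> R) :
  S `<=` B -> (forall z, B z -> ~ S z -> g z = 0) ->
  \int[m]_(z in S) g z = \int[m]_(z in B) g z.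
Proof.
move=> SB g0; rewrite Rintegral_mkcond [RHS]Rintegral_mkcond.
apply: eq_Rintegral => z _; rewrite !patchE.
case: ifPn => [|zS]; first by rewrite !inE => /SB Bz; rewrite mem_set.
case: ifPn => // zB; rewrite g0//; first by rewrite inE in zB.
by rewrite notin_setE in zS.
Qed.

Variables (M : manifold1 R) (c : R) (zeta : R -> R -> R).
Hypotheses (c_gt0 : 0 < c) (zeta_test : test_function M c zeta).
Local Notation S := (supp_domain M c zeta).

Lemma test_function_continuous : 
  [/\ continuous_on_spacetime c zeta, continuous_on_spacetime c (dt zeta) &
      continuous_on_spacetime c (dx zeta)].
Proof.
have C1 := test_function_Ck _ _ _ zeta_test 1.
split=> t x tc; first exact: Ck_continuous C1 tc.
  exact: Ck_continuous (Ck_dt _ _ _ C1) tc.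
exact: Ck_continuous (Ck_dx _ _ _ C1) tc.
Qed.

Lemma supp_domain_integrable h : continuous_on_spacetime c h ->
  [/\ measurable_fun S (fun z => h z.1 z.2),
      exists C, forall z, S z -> `|h z.1 z.2| <= C &
      (mu \x mu)%E.-integrable S (EFin \o (fun z => h z.1 z.2))].
Proof.
have [a [b [x0 [x1 [[a0 ab bc x01] SB _ _ _]]]]] := test_function_box _ _ _ zeta_test c_gt0.
apply: (spacetime_integrable c h a b x0 x1) => //.
  exact: supp_domain_measurable.
by move=> z /SB[? /subset_itv_co_cc]; split.
Qed.

(** The derivatives of [A * zeta] in [t] and of [B * zeta] in [x] both have integral zero over the
    box. Fubini is used in two orders, so that the differentiated variable is the inner one and the
    boundary values finish. *)
Lemma divergence_theorem (A B At Bx : R -> R -> R) :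
  (forall t x, 0 < t < c -> is_derive t (1 : R) (fun s => A s x) (At t x)) ->
  (forall t x, 0 < t < c -> is_derive x (1 : R) (B t) (Bx t x)) ->
  continuous_on_spacetime c A -> continuous_on_spacetime c B ->
  continuous_on_spacetime c At -> continuous_on_spacetime c Bx ->
  (forall t, 0 < t < c -> function_on M (B t)) ->
  \int[(mu \x mu)%E]_(z in S) (A z.1 z.2 * dt zeta z.1 z.2 + B z.1 z.2 * dx zeta z.1 z.2) =
  - \int[(mu \x mu)%E]_(z in S) ((At z.1 z.2 + Bx z.1 z.2) * zeta z.1 z.2).
Proof.
move=> dA dB cA cB cAt cBx BM.
have [cz czt czx] := test_function_continuous.
have C1 := test_function_Ck _ _ _ zeta_test 1.
have [a [b [x0 [x1 [[a0 ab bc x01] SB BS bt bx]]]]] := test_function_box _ _ _ zeta_test c_gt0.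
pose h1 t x := At t x * zeta t x + A t x * dt zeta t x.
pose h2 t x := Bx t x * zeta t x + B t x * dx zeta t x.
have ch1 : continuous_on_spacetime c h1.
  by move=> t x tc; apply: cvgD; apply: cvgM; [exact: cAt|exact: cz|exact: cA|exact: czt].
have ch2 : continuous_on_spacetime c h2.
  by move=> t x tc; apply: cvgD; apply: cvgM; [exact: cBx|exact: cz|exact: cB|exact: czx].
have dh1 t x : 0 < t < c -> is_derive t (1 : R) (fun s => A s x * zeta s x) (h1 t x).
  by move=> tc; apply: is_derive_mul; [exact: dA|exact: Ck1_is_derive_dt C1 tc].
have dh2 t x : 0 < t < c -> is_derive x (1 : R) (fun y => B t y * zeta t y) (h2 t x).
  by move=> tc; apply: is_derive_mul; [exact: dB|exact: Ck1_is_derive_dx C1 tc].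
pose Box : set (R * R) := `[a, b] `*` `[x0, x1[.
have mBox : measurable Box by apply: measurableX.
have BoxC : Box `<=` `[a, b] `*` `[x0, x1] by move=> z [? /subset_itv_co_cc]; split.
have tabc t : a <= t <= b -> 0 < t < c.
  by move=> /andP[at_ tb]; rewrite (lt_le_trans a0)// (le_lt_trans tb).
(* Inside the box, every point of the support already lies in [S], so enlarging the domain only adds
   zeros. *)
have SBox h : (forall t x, ~ supp zeta (t, x) -> h t x = 0) ->
    \int[(mu \x mu)%E]_(z in S) h z.1 z.2 = \int[(mu \x mu)%E]_(z in Box) h z.1 z.2.
  move=> h0; apply: Rintegral_vanishing_outside => // -[t x] [/= tab xx] nS.
  apply: h0 => sx; apply: nS; apply: BS => //; by move: tab xx; rewrite /= !in_itv.
have I1 : \int[(mu \x mu)%E]_(z in S) h1 z.1 z.2 = 0.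
  rewrite SBox; last first.
    by move=> t x /(notin_supp zeta t x)[z1 z2 _]; rewrite /h1 z1 z2 !mulr0 addr0.
  have [mh [C hC] _] := spacetime_integrable _ _ _ _ _ _ _ a0 bc mBox BoxC ch1.
  rewrite -(Rintegral_ysection a b x0 x1 C)//.
  transitivity (\int[mu]_(x in [set: R]) (cst 0 : R -> R) x); last first.
    by rewrite Rintegral_cst// mul0r.
  apply: eq_Rintegral => x _.
  have [xx|xx] := boolP (x0 <= x < x1); last first.
    rewrite (_ : ysection _ _ = set0) ?Rintegral_set0//.
    rewrite -subset0 => t; rewrite /ysection/= inE => -[_ /=].
    by rewrite in_itv/= (negbTE xx).
  rewrite (_ : ysection _ _ = `[a, b]); last first.
    apply/seteqP; split => t; rewrite /ysection/= inE; first by case.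
    by move=> tab; split => //=; rewrite in_itv.
  have ch1x t : a <= t <= b -> {for t, continuous (fun t => h1 t x)}.
    by move=> /tabc tc; exact: continuous_pair_fst (ch1 t x tc).
  have -> := Rintegral_derivative _ (fun t => h1 t x) _ _ ab
    (fun t tab => dh1 t x (tabc t tab)) ch1x.
  by have [-> ->] := bt x xx; rewrite !mulr0 subrr.
have I2 : \int[(mu \x mu)%E]_(z in S) h2 z.1 z.2 = 0.
  rewrite SBox; last first.
    by move=> t x /(notin_supp zeta t x)[z1 _ z2]; rewrite /h2 z1 z2; rewrite !mulr0 addr0.
  have [mh [C hC] _] := spacetime_integrable _ _ _ _ _ _ _ a0 bc mBox BoxC ch2.
  rewrite -(Rintegral_xsection a b x0 x1 C)//.
  transitivity (\int[mu]_(t in [set: R]) (cst 0 : R -> R) t); last first.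
    by rewrite Rintegral_cst// mul0r.
  apply: eq_Rintegral => t _.
  have [tab|tab] := boolP (a <= t <= b); last first.
    rewrite (_ : xsection _ _ = set0) ?Rintegral_set0//.
    rewrite -subset0 => x; rewrite /xsection/= inE => -[/=].
    by rewrite in_itv/= (negbTE tab).
  have tc := tabc t tab.
  have cx x : {for x, continuous (h2 t)} by exact: continuous_pair_snd (ch2 t x tc).
  rewrite (_ : xsection _ _ = `[x0, x1[); last first.
    apply/seteqP; split => x; rewrite /xsection/= inE; first by case.
    by move=> xx; split => //=; rewrite in_itv.
  rewrite Rintegral_itv_bndo_bndc; last first.
    apply: (@integrableS _ _ _ mu `[x0, x1]) => //; first exact: subset_itv_co_cc.
    exact: continuous_segment_integrable.
  have -> := Rintegral_derivative _ (h2 t) _ _ x01 (fun x _ => dh2 t x tc) (fun x _ => cx x).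
  by rewrite bx ?subrr//; exact: BM.
have cE1 : continuous_on_spacetime c (fun t x => A t x * dt zeta t x + B t x * dx zeta t x).
  by move=> t x tc; apply: cvgD; apply: cvgM; [exact: cA|exact: czt|exact: cB|exact: czx].
have cE2 : continuous_on_spacetime c (fun t x => (At t x + Bx t x) * zeta t x).
  by move=> t x tc; apply: cvgM; [apply: cvgD; [exact: cAt|exact: cBx]|exact: cz].
have [_ _ i1] := supp_domain_integrable _ cE1.
have [_ _ i2] := supp_domain_integrable _ cE2.
have [_ _ j1] := supp_domain_integrable _ ch1.
have [_ _ j2] := supp_domain_integrable _ ch2.
have mS := supp_domain_measurable M c zeta.
apply/eqP; rewrite -subr_eq0 opprK; apply/eqP.
rewrite -RintegralD//.
transitivity (\int[(mu \x mu)%E]_(z in S) (h1 z.1 z.2 + h2 z.1 z.2)).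
  by apply: eq_Rintegral => z _; rewrite /h1 /h2; ring.
by rewrite RintegralD// I1 I2 addr0.
Qed.

End integration_on_spacetime.

(** * First variation *)

Lemma is_derive_cvg {R : realType} (F : R -> R) (a l : R) :
  h^-1 *: (F (h + a) - F a) @[h --> 0^'] --> l -> is_derive a (1 : R) F l.
Proof.
move=> Fl; have Fl' : h^-1 *: ((F \o shift a) (h *: (1 : R)) - F a) @[h --> 0^'] --> l.
  by under eq_fun do rewrite scaler1.
by apply: DeriveDef; [apply/cvg_ex; exists l|exact: cvg_lim Fl'].
Qed.

Lemma derive1_shift {R : realType} (f : R -> R) (a x : R) :
  derivable f (x + a) 1 -> derive1 (fun y => f (y + a)) x = derive1 f (x + a).
Proof.
move=> df; apply: is_derive_derive1; rewrite -[derive1 f _]mulr1.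
apply: (is_derive_comp (fun y => y + a)); last exact: derivable_is_derive1.
have := is_derive_add _ _ _ _ _ (is_derive_id x (1 : R)) (is_derive_cst a x (1 : R)).
by rewrite addr0.
Qed.

Section first_variation.
Context {R : realType}.
Local Notation mu := (@lebesgue_measure R).
Variables (M : manifold1 R) (p P rho : R -> R) (c : R) (gamma : R -> R -> R).
Hypothesis p_smooth : smooth [set r : R | 0 < r] p.
Hypothesis P_primitive : forall r : R, 0 < r -> is_derive r 1 P (p r).
Hypothesis rho_smooth : smooth setT rho.
Hypothesis rho_gt0 : forall x, 0 < rho x.
Hypothesis c_gt0 : 0 < c.
Hypothesis gamma_C2 : Ck 2 (spacetime c) gamma.
Hypothesis dx_gamma_gt0 : forall t x, 0 < t < c -> 0 < dx gamma t x.

Lemma density_continuous c' : continuous_on_spacetime c' (fun _ => rho).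
Proof.
move=> t x _; apply: (@continuous_comp _ _ _ snd rho); first exact: cvg_snd.
exact: is_derive_continuous (derivable_is_derive1 _ _ (rho_smooth 0 x I)).
Qed.

Lemma ddensity_continuous c' : continuous_on_spacetime c' (fun _ => derive1 rho).
Proof.
move=> t x _; apply: (@continuous_comp _ _ _ snd (derive1 rho)); first exact: cvg_snd.
have := rho_smooth 1 x I; rewrite derive1n1 => drho.
exact: is_derive_continuous (derivable_is_derive1 _ _ drho).
Qed.

Lemma dt_gamma_continuous : continuous_on_spacetime c (dt gamma).
Proof. by move=> t x tc; exact: Ck_continuous (Ck_dt _ _ _ gamma_C2) tc. Qed.

Lemma dx_gamma_continuous : continuous_on_spacetime c (dx gamma).
Proof. by move=> t x tc; exact: Ck_continuous (Ck_dx _ _ _ gamma_C2) tc. Qed.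

(** * Differentiation of the varied action under the integral sign *)

Section variation.
Variable zeta : R -> R -> R.
Hypothesis zeta_test : test_function M c zeta.
Local Notation S := (supp_domain M c zeta).

Let perturbed (e : R) (z : R * R) : R :=
  lagrangian P (dt gamma z.1 z.2 + e * dt zeta z.1 z.2)
    (dx gamma z.1 z.2 + e * dx zeta z.1 z.2) (rho z.2)
  * (dx gamma z.1 z.2 + e * dx zeta z.1 z.2).

Let dperturbed (e : R) (z : R * R) : R :=
  momentum (dt gamma z.1 z.2 + e * dt zeta z.1 z.2)
    (dx gamma z.1 z.2 + e * dx zeta z.1 z.2) (rho z.2) * dt zeta z.1 z.2 +
  flux p P (dt gamma z.1 z.2 + e * dt zeta z.1 z.2)
    (dx gamma z.1 z.2 + e * dx zeta z.1 z.2) (rho z.2) * dx zeta z.1 z.2.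

(** [S] need not be compact, since the period of the circle is half open; bounds are taken over the
    compact set [K] that contains it. *)
Let K := supp zeta `&` (setT `*` closure (fundamental_domain M)).

Let K_compact : compact K.
Proof. by have [] := zeta_test. Qed.

Let K_time t x : K (t, x) -> 0 < t < c.
Proof. by case=> /(supp_spacetime _ _ _ zeta_test). Qed.

Let S_K z : S z -> K z.
Proof. by move=> [? [_ ?]]; split => //; split => //; exact: subset_closure. Qed.

Let perturbation_radius : exists2 e0 : R, 0 < e0 &
  forall e z, `|e| <= e0 -> K z -> 0 < dx gamma z.1 z.2 + e * dx zeta z.1 z.2.
Proof.
have [_ _ czx] := test_function_continuous _ _ _ zeta_test.
have [C1 H1] : exists C, forall z, K z -> `|(dx gamma z.1 z.2)^-1| <= C.
  apply: (continuous_on_compact_bounded K (fun z => (dx gamma z.1 z.2)^-1)) => // -[t x] Kz.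
  apply: cvgV; last exact: dx_gamma_continuous (K_time _ _ Kz).
  by rewrite gt_eqF// dx_gamma_gt0// (K_time _ _ Kz).
have [C2 H2] : exists C, forall z, K z -> `|dx zeta z.1 z.2| <= C.
  apply: (continuous_on_compact_bounded K (fun z => dx zeta z.1 z.2)) => // -[t x] Kz.
  exact: czx (K_time _ _ Kz).
have n1 : 0 < `|C1| + 1 by rewrite ltr_wpDl.
have n2 : 0 < `|C2| + 1 by rewrite ltr_wpDl.
(* On [K] one has [gamma_x > 1 / (|C1| + 1)] and [|zeta_x| <= |C2| + 1], so this radius keeps the
   perturbation below [gamma_x]. *)
exists (((`|C1| + 1) * (`|C2| + 1))^-1); first by rewrite invr_gt0 mulr_gt0.
move=> e [t x] ee0 Kz /=.
have w0 := dx_gamma_gt0 t x (K_time _ _ Kz).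
have h1 := H1 _ Kz; have h2 := H2 _ Kz; rewrite /= in h1 h2.
move: (dx gamma t x) (dx zeta t x) w0 h1 h2 => w dw w0 h1 h2.
have w1 : (`|C1| + 1)^-1 < w.
  rewrite -[ltRHS]invrK ltf_pV2 ?posrE ?invr_gt0//.
  rewrite (le_lt_trans (ler_norm _))// (le_lt_trans h1)//.
  by rewrite (le_lt_trans (ler_norm _))// ltrDl.
have edw : `|e * dw| <= (`|C1| + 1)^-1.
  rewrite normrM (@le_trans _ _ (((`|C1| + 1) * (`|C2| + 1))^-1 * (`|C2| + 1)))//.
    rewrite ler_pM// (le_trans h2)// (le_trans (ler_norm _))// lerDl//.
  by rewrite invfM mulfVK// gt_eqF.
have := ler_norm (- (e * dw)); rewrite normrN; lra.
Qed.

(** Joint continuity in [(e, (t, x))] on a compact product gives a bound uniform in [e], the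
    constant that dominates the differentiation under the integral. *)
Let dperturbed_bound (e0 : R) :
  (forall e z, `|e| <= e0 -> K z -> 0 < dx gamma z.1 z.2 + e * dx zeta z.1 z.2) ->
  exists C, forall e z, `|e| <= e0 -> K z -> `|dperturbed e z| <= C.
Proof.
move=> w0; have [_ czt czx] := test_function_continuous _ _ _ zeta_test.
have csnd (h : R -> R -> R) e t x : continuous_on_spacetime c h -> 0 < t < c ->
    {for (e, (t, x)), continuous (fun y : R * (R * R) => h y.2.1 y.2.2)}.
  move=> ch tc; apply: (@continuous_comp _ _ _ snd (fun z : R * R => h z.1 z.2)).
    exact: cvg_snd.
  exact: ch.
suff cd y : (`[- e0, e0] `*` K) y ->
    {for y, continuous (fun y : R * (R * R) => dperturbed y.1 y.2)}.
  have [C HC] := continuous_on_compact_bounded _ _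
    (compact_setX (@segment_compact R (- e0) e0) K_compact) cd.
  exists C => e z ee0 Kz; apply: (HC (e, z)); split => //=.
  by rewrite in_itv/= -ler_norml.
case: y => e [t x] [/= ee0 Kz]; have tc := K_time _ _ Kz.
have {}ee0 : `|e| <= e0 by rewrite ler_norml; move: ee0; rewrite in_itv.
have cv : {for (e, (t, x)), continuous (fun y : R * (R * R) =>
    dt gamma y.2.1 y.2.2 + y.1 * dt zeta y.2.1 y.2.2)}.
  apply: cvgD; first exact: csnd dt_gamma_continuous tc.
  by apply: cvgM; [exact: cvg_fst|exact: csnd czt tc].
have cw : {for (e, (t, x)), continuous (fun y : R * (R * R) =>
    dx gamma y.2.1 y.2.2 + y.1 * dx zeta y.2.1 y.2.2)}.
  apply: cvgD; first exact: csnd dx_gamma_continuous tc.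
  by apply: cvgM; [exact: cvg_fst|exact: csnd czx tc].
have cr : {for (e, (t, x)), continuous (fun y : R * (R * R) => rho y.2.2)}.
  exact: (csnd (fun _ => rho)) (density_continuous c) tc.
have w1 := w0 e (t, x) ee0 Kz.
apply: cvgD; apply: cvgM.
- exact: (momentum_continuous _ _ _ _ cv cw cr w1).
- exact: csnd czt tc.
- exact: (flux_continuous p P p_smooth P_primitive _ _ _ _ cv cw cr w1 (rho_gt0 x)).
- exact: csnd czx tc.
Qed.

Let varied_actionE (e : R) :
  (forall z, K z -> 0 < dx gamma z.1 z.2 + e * dx zeta z.1 z.2) ->
  (mu \x mu)%E.-integrable S (EFin \o perturbed e) /\
  varied_action M c (lagrangian P) gamma rho zeta e =
    \int[(mu \x mu)%E]_(z in S) perturbed e z.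
Proof.
move=> w0; have [_ czt czx] := test_function_continuous _ _ _ zeta_test.
have mS := supp_domain_measurable M c zeta.
have cperturbed z : K z -> {for z, continuous (perturbed e)}.
  case: z => t x Kz; have tc := K_time _ _ Kz.
  have cv : {for (t, x), continuous (fun y : R * R =>
      dt gamma y.1 y.2 + e * dt zeta y.1 y.2)}.
    apply: cvgD; first exact: dt_gamma_continuous tc.
    by apply: cvgM; [exact: cvg_cst|exact: czt tc].
  have cw : {for (t, x), continuous (fun y : R * R =>
      dx gamma y.1 y.2 + e * dx zeta y.1 y.2)}.
    apply: cvgD; first exact: dx_gamma_continuous tc.
    by apply: cvgM; [exact: cvg_cst|exact: czx tc].
  apply: cvgM; last exact: cw.
  exact: (lagrangian_continuous p P P_primitive _ _ _ _ cv cw (density_continuous c t x tc)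
    (w0 _ Kz) (rho_gt0 x)).
have mperturbed : measurable_fun S (perturbed e).
  by apply: continuous_on_prod_measurable => // z /S_K; exact: cperturbed.
have [C HC] := continuous_on_compact_bounded _ _ K_compact cperturbed.
have SC z : S z -> `|perturbed e z| <= C by move=> /S_K; exact: HC.
have [a [b [x0 [x1 [_ SB _ _ _]]]]] := test_function_box _ _ _ zeta_test c_gt0.
have SB' : S `<=` `[a, b] `*` `[x0, x1].
  by move=> z /SB[? /subset_itv_co_cc]; split.
split; first exact: (bounded_prod_integrable a b x0 x1 C S (fun t x => perturbed e (t, x))).
rewrite -[RHS](Rintegral_xsection a b x0 x1 C S (fun t x => perturbed e (t, x)))//.
rewrite /varied_action [LHS]Rintegral_mkcond; apply: eq_Rintegral => t _.
rewrite patchE; case: ifPn => tc.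
  congr (Rintegral _ _ _); apply/seteqP; split => x; rewrite /xsection/= !inE.
    by move=> [Fx sx]; split => //; split => //; rewrite inE in tc.
  by move=> [sx [_ Fx]].
rewrite (_ : xsection _ _ = set0) ?Rintegral_set0// -subset0 => x.
by rewrite /xsection/= inE => -[_ [/= t0c _]]; move: tc; rewrite notin_setE.
Qed.

Lemma varied_action_is_derive :
  is_derive (0 : R) 1 (varied_action M c (lagrangian P) gamma rho zeta)
    (\int[(mu \x mu)%E]_(z in S)
       (momentum (dt gamma z.1 z.2) (dx gamma z.1 z.2) (rho z.2) * dt zeta z.1 z.2 +
        flux p P (dt gamma z.1 z.2) (dx gamma z.1 z.2) (rho z.2) * dx zeta z.1 z.2)).
Proof.
have [e0 e00 w0] := perturbation_radius.
have [C HC] := dperturbed_bound e0 w0.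
have mS := supp_domain_measurable M c zeta.
have small e : `]- e0, e0[ e -> `|e| <= e0.
  by rewrite /= in_itv/= -ltr_norml => /ltW.
(* The iterated integral is replaced by a plane integral only for [|e| < e0], where the perturbed
   [gamma_x] is positive; the derivative at [0] sees nothing else. *)
apply: (@near_eq_is_derive _ _ _
    (fun e => \int[(mu \x mu)%E]_(z in S) perturbed e z)).
  apply/nbhs_ballP; exists e0 => //= e; rewrite /ball/= sub0r normrN => /ltW ee0.
  by rewrite (varied_actionE _ (fun z => w0 e z ee0)).2.
have D e z : `]- e0, e0[ e -> S z -> is_derive e (1 : R) (perturbed ^~ z) (dperturbed e z).
  move=> /small ee0 /S_K Kz; apply: is_derive_perturbed_lagrangian => //.
  exact: w0.
have [a [b [x0 [x1 [_ SB _ _ _]]]]] := test_function_box _ _ _ zeta_test c_gt0.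
have SB' : S `<=` `[a, b] `*` `[x0, x1].
  by move=> z /SB[? /subset_itv_co_cc]; split.
have I0 : `]- e0, e0[ (0 : R) by rewrite /= in_itv/= oppr_lt0 e00.
have iG : (mu \x mu)%E.-integrable S (EFin \o cst `|C|).
  apply: (bounded_prod_integrable a b x0 x1 `|C| S (fun _ _ => `|C|)) => // z _.
  by rewrite normr_id.
have D1 e z : `]- e0, e0[ e -> S z -> partial1of2 perturbed e z = dperturbed e z.
  by move=> Ie Sz; exact: is_derive_derive1 (D e z Ie Sz).
have D1C e z : `]- e0, e0[ e -> S z -> `|partial1of2 perturbed e z| <= cst `|C| z.
  move=> Ie Sz; rewrite D1// (le_trans (HC e z (small e Ie) (S_K z Sz)))//.
  exact: ler_norm.
apply: is_derive_cvg.
rewrite [X in _ --> X](_ : _ = \int[(mu \x mu)%E]_(z in S) partial1of2 perturbed 0 z).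
  exact: (@cvg_differentiation_under_integral R _ _ (mu \x mu)%E perturbed S mS 0
    (- e0) e0 I0 (fun e Ie => (varied_actionE e (fun z => w0 e z (small e Ie))).1)
    (fun e z Ie Sz => is_derive_derivable _ _ _ (D e z Ie Sz))
    (cst `|C|) (fun _ => normr_ge0 C) iG D1C).
apply: eq_Rintegral => z; rewrite inE => Sz; rewrite D1//.
by rewrite /dperturbed !mul0r !addr0.
Qed.

End variation.

(** * The Euler-Lagrange expression along [gamma] and its periodicity *)

Definition euler_lagrange (t x : R) : R :=
  (rho x / dx gamma t x) ^+ 2 * diffeo_operator p rho gamma t x.

Lemma euler_lagrange_continuous : continuous_on_spacetime c euler_lagrange.
Proof.
move=> t x tc.
have cv := dt_gamma_continuous t x tc; have cw := dx_gamma_continuous t x tc.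
have cr := density_continuous c t x tc; have cdr := ddensity_continuous c t x tc.
have ctt := Ck_continuous _ _ _ t x (Ck_dt _ _ _ (Ck_dt _ _ _ gamma_C2)) tc.
have ctx := Ck_continuous _ _ _ t x (Ck_dx _ _ _ (Ck_dt _ _ _ gamma_C2)) tc.
have cxx := Ck_continuous _ _ _ t x (Ck_dx _ _ _ (Ck_dx _ _ _ gamma_C2)) tc.
have w0 := dx_gamma_gt0 t x tc; have r0 := rho_gt0 x.
have cwi : {for (t, x), continuous (fun z : R * R => (dx gamma z.1 z.2)^-1)}.
  by apply: cvgV; [rewrite gt_eqF|exact: cw].
have cp : {for (t, x), continuous (fun z : R * R =>
    derive1 p (rho z.2 / dx gamma z.1 z.2) - dt gamma z.1 z.2 ^+ 2)}.
  apply: cvgB; last exact: (cvgM cv cv).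
  exact: (dpressure_ratio_continuous p p_smooth _ _ _ cw cr w0 r0).
have cri : {for (t, x), continuous (fun z : R * R => (rho z.2)^-1)}.
  by apply: cvgV; [rewrite gt_eqF|exact: cr].
have crw : {for (t, x), continuous (fun z : R * R => rho z.2 / dx gamma z.1 z.2)}.
  exact: (cvgM cr cwi).
apply: cvgM; first exact: (cvgM crw crw).
apply: cvgD; last exact: (cvgM (cvgM cdr cri) cp).
apply: cvgB; last exact: (cvgM (cvgM cwi cp) cxx).
apply: cvgB; first exact: (cvgM cw ctt).
by apply: cvgM; [apply: cvgM; [exact: cvg_cst|exact: cv]|exact: ctx].
Qed.

Hypothesis rho_on_M : function_on M rho.
Hypothesis gamma_on_M : forall t, 0 < t < c -> lift_on M (gamma t).

Let near_time t : 0 < t < c -> \forall s \near t, 0 < s < c.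
Proof.
move=> tc; have : nbhs t `]0, c[.
  by apply: open_nbhs_nbhs; split; [exact: interval_open|rewrite /= in_itv].
by apply: filterS => s; rewrite /= in_itv.
Qed.

Lemma dt_function_on (g : R -> R -> R) : (forall t, 0 < t < c -> function_on M (g t)) ->
  forall t, 0 < t < c -> function_on M (dt g t).
Proof.
case: M => // l gl t tc x; rewrite /dt !derive1E; apply: near_eq_derive.
by apply: filterS (near_time t tc) => s sc; exact: gl.
Qed.

Lemma dx_function_on (g : R -> R -> R) k : Ck k.+1 (spacetime c) g ->
  (forall t, 0 < t < c -> function_on M (g t)) ->
  forall t, 0 < t < c -> function_on M (dx g t).
Proof.
case: M => // l Cg gl t tc x; rewrite /dx -derive1_shift.
  by congr (derive1 _ x); apply/funext => y; exact: gl.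
exact: is_derive_derivable (Ck1_is_derive_dx _ _ _ t _ Cg tc).
Qed.

(** On the circle [gamma] is a lift and not periodic; the added period is a constant, which
    differentiation removes. *)
Lemma dt_gamma_function_on t : 0 < t < c -> function_on M (dt gamma t).
Proof.
move=> tc; move: gamma_on_M; case: M => // l gl x; apply: is_derive_derive1.
have Dg := Ck1_is_derive_dt _ _ _ t x gamma_C2 tc.
have Dgl : is_derive t (1 : R) (fun s => gamma s x + l%:num) (dt gamma t x).
  have := is_derive_add _ _ _ _ _ Dg (is_derive_cst l%:num t (1 : R)).
  by rewrite addr0.
apply: near_eq_is_derive Dgl.
by apply: filterS (near_time t tc) => s sc; rewrite gl.
Qed.

Lemma dx_gamma_function_on t : 0 < t < c -> function_on M (dx gamma t).
Proof.
move=> tc; move: gamma_on_M; case: M => // l gl x; rewrite /dx -derive1_shift.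
  rewrite (_ : (fun y => gamma t (y + l%:num)) = (fun y => gamma t y + l%:num)).
    apply: is_derive_derive1; rewrite -[derive1 _ _]addr0.
    exact: is_derive_add (Ck1_is_derive_dx _ _ _ t x gamma_C2 tc) _.
  by apply/funext => y; exact: gl.
exact: is_derive_derivable (Ck1_is_derive_dx _ _ _ t _ gamma_C2 tc).
Qed.

Lemma euler_lagrange_function_on t : 0 < t < c -> function_on M (euler_lagrange t).
Proof.
move=> tc.
have Ht := dt_gamma_function_on _ tc; have Hx := dx_gamma_function_on _ tc.
have Htt := dt_function_on _ dt_gamma_function_on _ tc.
have Htx := dx_function_on _ _ (Ck_dt _ _ _ gamma_C2) dt_gamma_function_on _ tc.
have Hxx := dx_function_on _ _ (Ck_dx _ _ _ gamma_C2) dx_gamma_function_on _ tc.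
have Hdr : function_on M (derive1 rho).
  move: rho_on_M; case: M => // l rl x.
  rewrite -derive1_shift; last exact: (rho_smooth 0 (x + l%:num) I).
  by congr (derive1 _ x); apply/funext => y; exact: rl.
move: rho_on_M Ht Hx Htt Htx Hxx Hdr; rewrite /euler_lagrange /diffeo_operator.
by case: M => // l rl Ht Hx Htt Htx Hxx Hdr x; rewrite rl Ht Hx Htt Htx Hxx Hdr.
Qed.

Lemma first_variation zeta : test_function M c zeta ->
  is_derive (0 : R) 1 (varied_action M c (lagrangian P) gamma rho zeta)
    (- \int[(mu \x mu)%E]_(z in supp_domain M c zeta)
        (euler_lagrange z.1 z.2 * zeta z.1 z.2)).
Proof.
move=> zt; have := varied_action_is_derive zeta zt.
move/is_derive_eq; apply.
pose A t x := momentum (dt gamma t x) (dx gamma t x) (rho x).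
pose B t x := flux p P (dt gamma t x) (dx gamma t x) (rho x).
pose At t x := rho x ^+ 2 * (dt (dt gamma) t x / dx gamma t x
  - dt gamma t x * dt (dx gamma) t x / dx gamma t x ^+ 2).
pose Bx t x := derive1 p (rho x / dx gamma t x) * (rho x / dx gamma t x)
    * (derive1 rho x / dx gamma t x - rho x * dx (dx gamma) t x / dx gamma t x ^+ 2)
  - (rho x * dt gamma t x / dx gamma t x)
    * ((derive1 rho x * dt gamma t x + rho x * dx (dt gamma) t x) / dx gamma t x
       - rho x * dt gamma t x * dx (dx gamma) t x / dx gamma t x ^+ 2).
have dA t x : 0 < t < c -> is_derive t (1 : R) (fun s => A s x) (At t x).
  move=> tc; have wn0 : dx gamma t x != 0 by rewrite gt_eqF// dx_gamma_gt0.
  exact: (is_derive_momentum (fun s => dt gamma s x) (fun s => dx gamma s x) _ _ _ _ wn0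
    (Ck1_is_derive_dt _ _ _ t x (Ck_dt _ _ _ gamma_C2) tc)
    (Ck1_is_derive_dt _ _ _ t x (Ck_dx _ _ _ gamma_C2) tc)).
have dB t x : 0 < t < c -> is_derive x (1 : R) (B t) (Bx t x).
  move=> tc.
  exact: (is_derive_flux p P p_smooth P_primitive _ _ _ _ _ _ _ (dx_gamma_gt0 t x tc)
    (rho_gt0 x) (Ck1_is_derive_dx _ _ _ t x (Ck_dt _ _ _ gamma_C2) tc)
    (Ck1_is_derive_dx _ _ _ t x (Ck_dx _ _ _ gamma_C2) tc)
    (derivable_is_derive1 _ _ (rho_smooth 0 x I))).
have cA : continuous_on_spacetime c A.
  move=> t x tc.
  exact: (momentum_continuous _ _ _ _ (dt_gamma_continuous t x tc)
    (dx_gamma_continuous t x tc) (density_continuous c t x tc) (dx_gamma_gt0 t x tc)).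
have cB : continuous_on_spacetime c B.
  move=> t x tc.
  exact: (flux_continuous p P p_smooth P_primitive _ _ _ _ (dt_gamma_continuous t x tc)
    (dx_gamma_continuous t x tc) (density_continuous c t x tc) (dx_gamma_gt0 t x tc)
    (rho_gt0 x)).
have cAt : continuous_on_spacetime c At.
  move=> t x tc.
  have cv := dt_gamma_continuous t x tc; have cw := dx_gamma_continuous t x tc.
  have cr := density_continuous c t x tc.
  have ctt := Ck_continuous _ _ _ t x (Ck_dt _ _ _ (Ck_dt _ _ _ gamma_C2)) tc.
  have cxt := Ck_continuous _ _ _ t x (Ck_dt _ _ _ (Ck_dx _ _ _ gamma_C2)) tc.
  have w0 := dx_gamma_gt0 t x tc.
  have wn0 : dx gamma t x != 0 by rewrite gt_eqF.
  apply: cvgM; first exact: (cvgM cr cr).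
  apply: cvgB; apply: cvgM; first exact: ctt.
  - by apply: cvgV; [exact: wn0|exact: cw].
  - exact: (cvgM cv cxt).
  - by apply: cvgV; [exact: expf_neq0|exact: (cvgM cw cw)].
have EL t x : 0 < t < c -> At t x + Bx t x = euler_lagrange t x.
  move=> tc; exact: (euler_lagrange_diffeo_operator p rho gamma c t x gamma_C2 tc
    (fun y => dx_gamma_gt0 t y tc) rho_gt0).
clearbody At Bx.
(* [Bx] is the difference of two continuous functions, the Euler-Lagrange expression and [At]. The
   identity holds only for times in the open interval, hence the passage to a neighbourhood. *)
have cBx : continuous_on_spacetime c Bx.
  move=> t x tc.
  have BxE s y : 0 < s < c -> euler_lagrange s y - At s y = Bx s y.
    by move=> /(EL s y) <-; rewrite [At s y + _]addrC addrK.
  have c0 : {for (t, x), continuous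
      (fun z : R * R => euler_lagrange z.1 z.2 - At z.1 z.2)}.
    by apply: cvgB; [exact: euler_lagrange_continuous|exact: cAt].
  have nb : nbhs (t, x) (spacetime c).
    by apply: open_nbhs_nbhs; split; [exact: spacetime_open|apply/spacetimeE].
  move: c0; rewrite /prop_for /continuous_at /= BxE//; apply: cvg_trans.
  apply: near_eq_cvg; apply: filterS nb => -[s y] /spacetimeE sc /=.
  by rewrite BxE.
have BM t : 0 < t < c -> function_on M (B t).
  move=> tc; have Ht := dt_gamma_function_on _ tc; have Hx := dx_gamma_function_on _ tc.
  move: rho_on_M Ht Hx; rewrite /B.
  by case: M => // l rl Ht Hx x; rewrite rl Ht Hx.
rewrite (divergence_theorem M c zeta c_gt0 zt A B At Bx)//.
congr (- _); apply: eq_Rintegral => -[t x]; rewrite inE => -[_ [/= tc _]].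
by rewrite (EL t x)//; move: tc; rewrite in_itv.
Qed.

End first_variation.

(** * Fundamental lemma *)

Section fundamental_lemma.
Context {R : realType}.
Local Notation mu := (@lebesgue_measure R).

Lemma fundamental_domain_representative (M : manifold1 R) (x : R) :
  exists2 y, fundamental_domain M y & forall h, function_on M h -> h y = h x.
Proof.
case: M => [|l]; first by exists x.
pose n := Num.floor (x / l%:num).
exists (x - n%:~R * l%:num); last by move=> h; exact: function_on_circle_shift.
have := floor_itv (x / l%:num); rewrite -/n intrD1 ler_pdivlMr// ltr_pdivrMr// mulrDl mul1r.
by move=> /andP[n1 n2]; rewrite /= in_itv/= subr_ge0 n1 ltrBlDl.
Qed.

(** Room is available only to the right, since [x] may be the left end [0] of the period. It
    provides a square of positive measure inside the domain of integration. *)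
Lemma fundamental_domain_right_segment (M : manifold1 R) (x : R) :
  fundamental_domain M x -> exists2 d : R, 0 < d &
    forall y, x <= y <= x + d -> fundamental_domain M y.
Proof.
case: M => [|l] /=; first by exists 1.
rewrite in_itv/= => /andP[x0 xl].
have lx : 0 < l%:num - x by rewrite subr_gt0.
exists ((l%:num - x) / 2); first by rewrite divr_gt0.
by move=> y /andP[xy yx]; rewrite in_itv/= (le_trans x0 xy)/=; lra.
Qed.

(** For a bump supported where [E > 0], the integrand is nonnegative everywhere and at least
    [eta > 0] on a square [Q] inside the domain. *)
Lemma positive_test_integral (M : manifold1 R) (c : R) (E : R -> R -> R) (t0 x0 : R) :
  0 < c -> continuous_on_spacetime c E ->
  (forall t, 0 < t < c -> function_on M (E t)) ->
  0 < t0 < c -> fundamental_domain M x0 -> 0 < E t0 x0 ->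
  exists2 zeta, test_function M c zeta &
    0 < \int[(mu \x mu)%E]_(z in supp_domain M c zeta) (E z.1 z.2 * zeta z.1 z.2).
Proof.
move=> c0 cE EM tc Fx0 E0.
have [d d0 Ed] : exists2 d : R, 0 < d &
    forall t x, `|t - t0| < d -> `|x - x0| < d -> 0 < E t x.
  have /cvgrPdist_lt/(_ _ E0)/nbhs_ballP[d /= d0 dE] := cE t0 x0 tc.
  exists d => // t x td xd; have := dE (t, x).
  rewrite /ball/= /prod_ball/= /ball/= ![`|t0 - t|]distrC ![`|x0 - x|]distrC.
  move=> /(_ (conj td xd)); rewrite ltr_distlC subrr => /andP[//].
have [zeta [zt z0 zt0 zd]] := test_function_bump M c t0 x0 d tc d0.
exists zeta => //; pose f t x := E t x * zeta t x.
have [cz _ _] := test_function_continuous _ _ _ zt.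
have cf : continuous_on_spacetime c f.
  by move=> t x tc'; apply: cvgM; [exact: cE|exact: cz].
(* On the circle the bump also lives at the translates of [x0]; the representative [y] carries the
   sign of [E] to them. *)
have f0 t x : 0 <= f t x.
  have [ztx|] := eqVneq (zeta t x) 0; first by rewrite /f ztx mulr0.
  move=> /zd[tc' td [y yd yx]]; rewrite /f mulr_ge0// -(yx _ (EM t tc')) ltW//.
  exact: Ed.
have ft0 : 0 < f t0 x0 by rewrite mulr_gt0.
pose eta := f t0 x0 / 2; have eta0 : 0 < eta by rewrite divr_gt0.
have [d1 d10 fd1] : exists2 d : R, 0 < d &
    forall t x, `|t - t0| < d -> `|x - x0| < d -> eta <= f t x.
  have /cvgrPdist_lt/(_ _ eta0)/nbhs_ballP[d1 /= d10 dE] := cf t0 x0 tc.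
  exists d1 => // t x td xd; have := dE (t, x).
  rewrite /ball/= /prod_ball/= /ball/= ![`|t0 - t|]distrC ![`|x0 - x|]distrC.
  move=> /(_ (conj td xd)); rewrite ltr_distlC => /andP[+ _].
  by move=> /ltW; rewrite /eta; lra.
have [d2 d20 Fd2] := fundamental_domain_right_segment M x0 Fx0.
pose e := Num.min (Num.min d1 d2) (c - t0) / 2.
have m0 : 0 < Num.min (Num.min d1 d2) (c - t0).
  by rewrite !lt_min d10 d20 subr_gt0; case/andP: tc.
have e0 : 0 < e by rewrite divr_gt0.
have : e < Num.min (Num.min d1 d2) (c - t0) by rewrite ltr_pdivrMr// ltr_pMr// ltr1n.
rewrite !lt_min => /andP[/andP[ed1 ed2] ec].
pose Q : set (R * R) := `[t0, t0 + e] `*` `[x0, x0 + e].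
have Qf z : Q z -> eta <= f z.1 z.2.
  case: z => t x [/=]; rewrite !in_itv/= => /andP[t1 t2] /andP[y1 y2].
  by apply: fd1; rewrite ger0_norm ?subr_ge0//; lra.
have QS : Q `<=` supp_domain M c zeta.
  move=> [t x] Qtx; have := Qf _ Qtx => /= etaf.
  have [/= t1 x1] := Qtx; rewrite !in_itv/= in t1 x1.
  split.
    apply: subset_closure => /=; apply/eqP => ztx.
    by move: etaf; rewrite /f ztx mulr0 leNgt eta0.
  split; last by apply: Fd2 => /=; lra.
  by rewrite /= in_itv/=; case/andP: tc; case/andP: t1 => *; apply/andP; split; lra.
have mQ : measurable Q by apply: measurableX.
have [mf [C HC] intf] := supp_domain_integrable _ _ _ c0 zt _ cf.
have mS := supp_domain_measurable M c zeta.
rewrite lt_neqAle Rintegral_ge0 ?andbT; last by move=> z _; exact: f0.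
apply/eqP => I0.
(* If the integral were zero, [eta] times the area of [Q] would be at most the integral over [Q],
   hence at most zero. *)
have : (eta%:E * (mu \x mu)%E Q <= 0)%E.
  rewrite -integral_cst//.
  apply: (@le_trans _ _ (\int[(mu \x mu)%E]_(z in Q) (f z.1 z.2)%:E)%E).
    apply: ge0_le_integral => //.
    - by move=> z _; rewrite lee_fin ltW.
    - by apply/measurable_EFinP; apply: measurable_funS mf.
  apply: (@le_trans _ _ (\int[(mu \x mu)%E]_(z in supp_domain M c zeta) (f z.1 z.2)%:E)%E).
    apply: ge0_subset_integral => //; first exact/measurable_EFinP.
    by move=> z _; rewrite lee_fin.
  have <- : (\int[(mu \x mu)%E]_(z in supp_domain M c zeta) f z.1 z.2)%:E =
      (\int[(mu \x mu)%E]_(z in supp_domain M c zeta) (f z.1 z.2)%:E)%E.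
    by rewrite /Rintegral fineK//; apply: integrable_fin_num.
  by rewrite -I0.
rewrite product_measure1E//= !lebesgue_measure_itv/= !lte_fin !ltrDl e0.
rewrite -!EFinD ![t0 + _]addrC ![x0 + _]addrC !addrK -!EFinM lee_fin leNgt.
by rewrite !mulr_gt0.
Qed.

(** Periodicity moves the point into the fundamental domain; there a positive value is excluded by a
    bump, and a negative one by the same argument for [- E]. *)
Lemma fundamental_lemma_calculus_of_variations (M : manifold1 R) (c : R) (E : R -> R -> R) :
  0 < c -> continuous_on_spacetime c E ->
  (forall t, 0 < t < c -> function_on M (E t)) ->
  (forall zeta, test_function M c zeta ->
    \int[(mu \x mu)%E]_(z in supp_domain M c zeta) (E z.1 z.2 * zeta z.1 z.2) = 0) ->
  forall t x, 0 < t < c -> E t x = 0.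
Proof.
move=> c0 cE EM IE t x tc.
have [y Fy yx] := fundamental_domain_representative M x; rewrite -(yx _ (EM t tc)).
have [E0|E0|//] := ltgtP (E t y) 0.
  have cNE : continuous_on_spacetime c (fun t x => - E t x).
    by move=> s z sc; apply: cvgN; exact: cE.
  have NEM s : 0 < s < c -> function_on M (fun x => - E s x).
    by move=> /EM; case: (M) => // l El z; rewrite El.
  have NE0 : 0 < - E t y by rewrite oppr_gt0.
  have [zeta zt] := positive_test_integral M c (fun t x => - E t x) t y c0 cNE NEM tc Fy NE0.
  have [cz _ _] := test_function_continuous _ _ _ zt.
  have [_ _ i] := supp_domain_integrable _ _ _ c0 zt (fun t x => E t x * zeta t x)
    (fun t x tc => cvgM (cE t x tc) (cz t x tc)).
  under eq_Rintegral do rewrite mulNr -mulN1r.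
  rewrite RintegralZl//; last exact: supp_domain_measurable.
  by rewrite IE// mulr0 ltxx.
have [zeta zt] := positive_test_integral M c E t y c0 cE EM tc Fy E0.
by rewrite IE// ltxx.
Qed.

End fundamental_lemma.

(** * Equality of the two actions and equation of the extremals *)

Theorem mainTheorem4 (R : realType) (M : manifold1 R) (p P rho0 : R -> R) (c : R)
  (p_smooth : smooth [set r | 0 < r] p)
  (P_primitive : forall r : R, 0 < r -> is_derive r 1 P (p r))
  (rho0_on_M : function_on M rho0)
  (rho0_smooth : smooth setT rho0)
  (rho0_gt0 : forall x, 0 < rho0 x)
  (c_gt0 : 0 < c) :
  forall gamma : R -> R -> R, C2_diffeo_path M c gamma ->
    action M c (lagrangian P) gamma rho0 =
      pulled_back_action M c (lagrangian P) gamma rho0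
    /\ (extremal M c (lagrangian P) gamma rho0 <->
        diffeo_equation c p rho0 gamma).
Proof.
move=> gamma [gamma_C2 gamma_diffeo].
have gamma_on_M t : 0 < t < c -> lift_on M (gamma t) by case/gamma_diffeo.
have w0 t x : 0 < t < c -> 0 < dx gamma t x by case/gamma_diffeo.
have Ht := dt_gamma_function_on M c gamma gamma_C2 gamma_on_M.
have Hx := dx_gamma_function_on M c gamma gamma_C2 gamma_on_M.
split.
  apply: eq_integral => t; rewrite inE/= in_itv/= => tc.
  have [_ gamma_bij _] := gamma_diffeo t tc.
  have Dg x : is_derive x (1 : R) (gamma t) (dx gamma t x).
    exact: Ck1_is_derive_dx gamma_C2 tc.
  have cdg : continuous (dx gamma t).
    by move=> x; exact: continuous_pair_snd (dx_gamma_continuous c gamma gamma_C2 t x tc).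
  pose F x := lagrangian P (dt gamma t x) (dx gamma t x) (rho0 x).
  have cF : continuous F.
    move=> x; apply: (lagrangian_continuous p P P_primitive (dt gamma t) (dx gamma t) rho0).
    - exact: continuous_pair_snd (dt_gamma_continuous c gamma gamma_C2 t x tc).
    - exact: cdg.
    - exact: continuous_pair_snd (density_continuous rho0 rho0_smooth c t x tc).
    - exact: w0.
    - exact: rho0_gt0.
  case: M rho0_on_M gamma_on_M Ht Hx {gamma_diffeo} => [|l] rl gl Ht Hx /=.
    exact: (line_change_of_variables (gamma t) (dx gamma t) gamma_bij Dg
      (fun x => w0 t x tc) cdg F cF).
  apply: (circle_change_of_variables (gamma t) (dx gamma t) gamma_bij Dg
      (fun x => w0 t x tc) cdg F l%:num) => //.
  - by move=> x; rewrite /F (Ht t tc) (Hx t tc) rl.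
  - exact: gl.
  - exact: Hx.
have first zeta := first_variation M p P rho0 c gamma p_smooth P_primitive rho0_smooth
  rho0_gt0 c_gt0 gamma_C2 w0 rho0_on_M gamma_on_M zeta.
split=> [ext|eqn].
  move=> t x tc.
  have EL0 := fundamental_lemma_calculus_of_variations M c
    (euler_lagrange p rho0 gamma) c_gt0
    (euler_lagrange_continuous p rho0 c gamma p_smooth rho0_smooth rho0_gt0 gamma_C2 w0)
    (euler_lagrange_function_on M p rho0 c gamma rho0_smooth gamma_C2 rho0_on_M gamma_on_M).
  have {}EL0 : euler_lagrange p rho0 gamma t x = 0.
    apply: EL0 => // zeta zt; apply/eqP; rewrite -oppr_eq0; apply/eqP.
    (* [first] and [ext] both give the derivative of the varied action at [0], so their values
       agree. *)
    rewrite -(@derive_val _ _ _ _ _ _ _ (first zeta zt)).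
    exact: (@derive_val _ _ _ _ _ _ _ (ext zeta zt)).
  move/eqP: EL0; rewrite /euler_lagrange mulf_eq0 expf_eq0/= => /orP[|/eqP//].
  by rewrite gt_eqF// divr_gt0// w0.
move=> zeta zt; have := first zeta zt; move/is_derive_eq; apply.
rewrite (_ : \int[_]_(z in _) _ = 0) ?oppr0//.
rewrite -[RHS](mul0r (fine ((lebesgue_measure \x lebesgue_measure)%E (supp_domain M c zeta)))).
rewrite -Rintegral_cst; last exact: supp_domain_measurable.
apply: eq_Rintegral => -[t x]; rewrite inE => -[_ [/= + _]]; rewrite in_itv/= => tc.
by rewrite /euler_lagrange /diffeo_operator eqn// mulr0 mul0r.
Qed.
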